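(* (Termination of evaluation for the language Tores.) If $\Delta;\Xi;\Gamma\vdash t\Leftarrow T$ or $\Delta;\Xi;\Gamma\vdash t\Rightarrow T$, and $\vdash\theta:\Delta$, $\eta\in[\![\Xi]\!](\theta)$ and $\sigma\in[\![\Gamma]\!](\theta;\eta)$, then $t[\theta;\sigma]\Downarrow v$ for some $v\in[\![T]\!](\theta;\eta)$.
   Context: INDEX LANGUAGE. Fix an index language with index types $U$, index terms $M,N$ (possibly containing index variables $u$), index contexts $\Delta::=\cdot\mid\Delta,u{:}U$, index substitutions $\Theta::=\cdot\mid\Theta,M/u$, and judgments $\Delta\vdash U\ \mathsf{itype}$, $\Delta\vdash M:U$, $\Delta\vdash M=N$. Index types may depend on index variables; index equality is syntactic equality. There is an index type $\mathsf{nat}$ with constructors $0$ and $\mathsf{suc}\,M$ whose closed inhabitants are exactly the numerals (in the concrete instance $\mathsf{nat}$ is the only index type and terms are $0$, $\mathsf{suc}\,M$, $u$). Substitution typing: $\Delta'\vdash\cdot:\cdot$; and $\Delta'\vdash\Theta,M/u:\Delta,u{:}U$ if $\Delta'\vdash\Theta:\Delta$ and $\Delta'\vdash M:U[\Theta]$. Composition: $(\cdot)[\Theta_2]=\cdot$, $(\Theta_1,M/u)[\Theta_2]=\Theta_1[\Theta_2],M[\Theta_2]/u$. Spines: $\Delta\vdash\cdot:(\cdot)$; and $\Delta\vdash M_0,\vec M:(u_0{:}U_0,\overrightarrow{u{:}U})$ if $\Delta\vdash M_0:U_0$ and $\Delta\vdash\vec M:(\overrightarrow{u{:}U})[M_0/u_0]$;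 similarly $(u_0{:}U_0,\overrightarrow{u{:}U})$ is an $\mathsf{itype}$ spine in $\Delta$ if $U_0$ is an itype in $\Delta$ and the rest is one in $\Delta,u_0{:}U_0$. An index environment $\theta$ is a closed substitution; $\vdash\theta:\Delta$ means $\cdot\vdash\theta:\Delta$. Unification is a judgment $\Delta\vdash M\doteqdot N\searrow P$ with $P=(\Delta'\mid\Theta)$ or $P=\#$; matching is a judgment $\Delta_1\vdash\Theta_1\doteq\Theta_2\searrow(\Delta_2\mid\Theta)$ on substitutions (and similarly on terms). Assumed: index typing and equality are decidable; typing and equality are preserved by single and simultaneous substitution; $M[\Theta_1][\Theta_2]=M[\Theta_1[\Theta_2]]$; unification is decidable, $P=(\Delta'\mid\Theta)$ being the most general unifier, unique up to $\alpha$-equivalence (so $\Delta'\vdash\Theta:\Delta$ and $\Delta'\vdash M[\Theta]=N[\Theta]$), and $P=\#$ only if there is no unifier; matching is sound: if $\Delta_1\vdash\Theta_1:\Delta$ and $\Delta_1\vdash\Theta_1\doteq\Theta_2\searrow(\Delta_2\mid\Theta)$ then $\Delta_2\vdash\Theta:\Delta_1$ and $\Delta_2\vdash\Theta_1[\Theta]=\Theta_2$; matching is complete: if $\vdash\theta:\Delta$, $\vdash M[\theta]=N[\theta]$ and $\Delta\vdash M\doteqdot N\searrow(\Delta'\mid\Theta)$ then $\Delta'\vdash\Theta\doteq\theta\searrow(\cdot\mid\theta')$ for some $\theta'$. TYPES. Kinds $K::=*\mid\Pi u{:}U.K$. Types $T::=1\mid T_1\times T_2\mid T_1+T_2\mid(\overrightarrow{u{:}U});T_1\to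 T_2\mid\Sigma u{:}U.T\mid M=N\mid T\,M\mid\Lambda u.T\mid X\mid\mu X{:}K.T\mid\nu X{:}K.T\mid T_{\mathsf{Rec}}$ with $T_{\mathsf{Rec}}=\mathsf{Rec}_K(0\mapsto T_0\mid\mathsf{suc}\,u,X\mapsto T_s)$. In $(\overrightarrow{u{:}U});T_1\to T_2$ the $\vec u$ are bound in both $T_1,T_2$. Type variable contexts $\Xi::=\cdot\mid\Xi,X{:}K$; typing contexts $\Gamma::=\cdot\mid\Gamma,x{:}T$. Expressions are taken up to $\alpha$-equivalence. Kind checking $\Delta;\Xi\vdash T\Leftarrow K$: $1\Leftarrow*$; $T_1\times T_2\Leftarrow*$ and $T_1+T_2\Leftarrow *$ if $T_1,T_2\Leftarrow*$; $(\overrightarrow{u{:}U});S\to T\Leftarrow*$ if $(\overrightarrow{u{:}U})$ is an itype spine and $S,T\Leftarrow*$ in $\Delta,\overrightarrow{u{:}U};\Xi$; $\Sigma u{:}U.T\Leftarrow*$ if $U$ is an itype and $T\Leftarrow*$ in $\Delta,u{:}U;\Xi$; $M=N\Leftarrow*$ if $\Delta\vdash M:U$ and $\Delta\vdash N:U$; $\Lambda u.T\Leftarrow\Pi u{:}U.K$ if $T\Leftarrow K$ in $\Delta,u{:}U;\Xi$; $T\Leftarrow*$ if $T\Rightarrow*$. Kind synthesis: $X\Rightarrow K$ if $X{:}K\in\Xi$; $T\,M\Rightarrow K[M/u]$ if $T\Rightarrow\Pi u{:}U.K$ and $\Delta\vdash M:U$; $\mu X{:}K.T\Rightarrow K$ and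 $\nu X{:}K.T\Rightarrow K$ if $\Delta;\Xi,X{:}K\vdash T\Leftarrow K$; $\mathsf{Rec}_K(0\mapsto T_0\mid\mathsf{suc}\,u,X\mapsto T_s)\Rightarrow K$ if $K=\Pi u{:}\mathsf{nat}.K'$, $\Delta;\Xi\vdash T_0\Leftarrow K'[0/u]$ and $\Delta,u{:}\mathsf{nat};\Xi,X{:}K'\vdash T_s\Leftarrow K'[\mathsf{suc}\,u/u]$. An applied lambda $(\Lambda\vec u.T)\,\vec M$ is identified with $T[\overrightarrow{M/u}]$. Typing judgments presuppose that their contexts and types (including annotations) are well-kinded. TERMS. $t,s::=x\mid\langle\rangle\mid\lambda\vec u,x.t\mid t\,\vec M\,s\mid\langle t_1,t_2\rangle\mid\mathtt{split}\,s\,\mathtt{as}\,\langle x_1,x_2\rangle\,\mathtt{in}\,t\mid\mathtt{in}_i\,t\ (i=1,2)\mid(\mathtt{case}\,t\,\mathtt{of}\,\mathtt{in}_1x_1\mapsto t_1\mid\mathtt{in}_2x_2\mapsto t_2)\mid\mathtt{pack}(M,t)\mid\mathtt{unpack}\,t\,\mathtt{as}\,(u,x)\,\mathtt{in}\,s\mid\mathtt{refl}\mid\mathtt{eq}\,s\,\mathtt{with}\,(\Delta.\Theta\mapsto t)\mid\mathtt{eq\_abort}\,s\mid\mathtt{in}_\mu\,t\mid\mathtt{rec}\,f.t\mid\mathtt{corec}\,f.t\mid\mathtt{out}_\nu\,t\mid\mathtt{in}_l\,t\mid\mathtt{out}_l\,t\mid\mathtt{ind}(t_0,\,u,f.\,t_s)\mid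 t{:}T$, where $l\in\{0,\mathsf{suc}\}$. TYPING (contexts $\Delta;\Xi;\Gamma$ left implicit unless changed; bound variables are fresh for the conclusion). Checking: $\langle\rangle\Leftarrow1$. $\langle t_1,t_2\rangle\Leftarrow T_1\times T_2$ if $t_i\Leftarrow T_i$. $\mathtt{split}\,p\,\mathtt{as}\,\langle x_1,x_2\rangle\,\mathtt{in}\,t\Leftarrow T$ if $p\Rightarrow T_1\times T_2$ and $t\Leftarrow T$ with $x_1{:}T_1,x_2{:}T_2$ added to $\Gamma$. $\mathtt{in}_i\,t\Leftarrow T_1+T_2$ if $t\Leftarrow T_i$. The $\mathtt{case}$ term $\Leftarrow S$ if $t\Rightarrow T_1+T_2$ and each $t_i\Leftarrow S$ with $x_i{:}T_i$ added. $\mathtt{pack}(M,t)\Leftarrow\Sigma u{:}U.T$ if $\Delta\vdash M:U$ and $t\Leftarrow T[M/u]$. $\mathtt{unpack}\,t\,\mathtt{as}\,(u,x)\,\mathtt{in}\,s\Leftarrow S$ if $t\Rightarrow\Sigma u{:}U.T$ and $s\Leftarrow S$ in $\Delta,u{:}U;\Xi;\Gamma,x{:}T$. $\mathtt{refl}\Leftarrow M=N$ if $\Delta\vdash M=N$. $\mathtt{eq\_abort}\,s\Leftarrow T$ if $s\Rightarrow M=N$ and $\Delta\vdash M\doteqdot N\searrow\#$. $\mathtt{eq}\,s\,\mathtt{with}\,(\Delta'.\Theta\mapsto t)\Leftarrow T$ if $s\Rightarrow M=N$, $\Delta\vdash M\doteqdot N\searrow(\Delta'\mid\Theta)$ and $\Delta';\Xi[\Theta];\Gamma[\Theta]\vdash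 t\Leftarrow T[\Theta]$. $\lambda\vec u,x.t\Leftarrow(\overrightarrow{u{:}U});S\to T$ if $t\Leftarrow T$ in $\Delta,\overrightarrow{u{:}U};\Xi;\Gamma,x{:}S$. $\mathtt{in}_\mu\,t\Leftarrow(\mu X{:}K.\Lambda\vec u.T)\,\vec M$ if $t\Leftarrow T[\overrightarrow{M/u};(\mu X{:}K.\Lambda\vec u.T)/X]$. $\mathtt{rec}\,f.t\Leftarrow(\overrightarrow{u{:}U});(\mu X{:}K.\Lambda\vec v.S)\,\vec u\to T$ if $\Delta;\Xi,X{:}K;\Gamma,f{:}((\overrightarrow{u{:}U});X\,\vec u\to T)\vdash t\Leftarrow(\overrightarrow{u{:}U});S[\overrightarrow{u/v}]\to T$. $\mathtt{corec}\,f.t\Leftarrow(\overrightarrow{u{:}U});S\to(\nu X{:}K.\Lambda\vec v.T)\,\vec u$ if $\Delta;\Xi,X{:}K;\Gamma,f{:}((\overrightarrow{u{:}U});S\to X\,\vec u)\vdash t\Leftarrow(\overrightarrow{u{:}U});S\to T[\overrightarrow{u/v}]$. (In these two rules $K=\Pi\overrightarrow{v{:}U}.*$ and $X$ does not occur in the conclusion outside its binder, in particular not in $t$.) $\mathtt{ind}(t_0,u,f.t_s)\Leftarrow(u{:}\mathsf{nat});1\to T$ if $t_0\Leftarrow T[0/u]$ and $\Delta,u{:}\mathsf{nat};\Xi;\Gamma,f{:}T\vdash t_s\Leftarrow T[\mathsf{suc}\,u/u]$. $\mathtt{in}_0\,t\Leftarrow T_{\mathsf{Rec}}\,0\,\vec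 M$ if $t\Leftarrow T_0\,\vec M$. $\mathtt{in}_{\mathsf{suc}}\,t\Leftarrow T_{\mathsf{Rec}}\,(\mathsf{suc}\,N)\,\vec M$ if $t\Leftarrow T_s[N/u;(T_{\mathsf{Rec}}\,N)/X]\,\vec M$. $t\Leftarrow T$ if $t\Rightarrow T$. Synthesis: $x\Rightarrow T$ if $x{:}T\in\Gamma$. $t\,\vec M\,s\Rightarrow T[\overrightarrow{M/u}]$ if $t\Rightarrow(\overrightarrow{u{:}U});S\to T$, $\Delta\vdash\vec M:(\overrightarrow{u{:}U})$ and $s\Leftarrow S[\overrightarrow{M/u}]$. $\mathtt{out}_0\,t\Rightarrow T_0\,\vec M$ if $t\Rightarrow T_{\mathsf{Rec}}\,0\,\vec M$. $\mathtt{out}_{\mathsf{suc}}\,t\Rightarrow T_s[N/u;(T_{\mathsf{Rec}}\,N)/X]\,\vec M$ if $t\Rightarrow T_{\mathsf{Rec}}\,(\mathsf{suc}\,N)\,\vec M$. $\mathtt{out}_\nu\,t\Rightarrow T[\overrightarrow{M/u};(\nu X{:}K.\Lambda\vec u.T)/X]$ if $t\Rightarrow(\nu X{:}K.\Lambda\vec u.T)\,\vec M$. $(t{:}T)\Rightarrow T$ if $t\Leftarrow T$. EVALUATION. Term environments $\sigma::=\cdot\mid\sigma,v/x$. Function values $g::=\lambda\vec u,x.t\mid\mathtt{rec}\,f.t\mid\mathtt{corec}\,f.t\mid\mathtt{ind}(t_0,u,f.t_s)$. Closures $c::=g[\theta;\sigma]\mid(\mathtt{corec}\,f.t)[\theta;\sigma]\cdot\vec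 N\,v$. Values $v::=c\mid\langle\rangle\mid\langle v_1,v_2\rangle\mid\mathtt{in}_i\,v\mid\mathtt{pack}(M,v)\mid\mathtt{refl}\mid\mathtt{in}_\mu\,v\mid\mathtt{in}_l\,v$. Three judgments $t[\theta;\sigma]\Downarrow v$, $c\cdot\vec N\,v\Downarrow w$, $c\cdot_{\mathtt{out}_\nu}\Downarrow w$ are defined inductively. (a) $x[\theta;\sigma]\Downarrow\sigma(x)$; $\langle\rangle$ and $\mathtt{refl}$ evaluate to themselves; $g[\theta;\sigma]\Downarrow g[\theta;\sigma]$ (a closure); pairs, $\mathtt{in}_i$, $\mathtt{in}_\mu$, $\mathtt{in}_l$ evaluate componentwise; $\mathtt{pack}(M,t)[\theta;\sigma]\Downarrow\mathtt{pack}(M[\theta],v)$ if $t[\theta;\sigma]\Downarrow v$; $(t{:}T)[\theta;\sigma]\Downarrow v$ if $t[\theta;\sigma]\Downarrow v$; $\mathtt{split}\,t\,\mathtt{as}\,\langle x_1,x_2\rangle\,\mathtt{in}\,s\Downarrow v$ if $t[\theta;\sigma]\Downarrow\langle v_1,v_2\rangle$ and $s[\theta;\sigma,v_1/x_1,v_2/x_2]\Downarrow v$; $\mathtt{case}$ evaluates to $v$ if $t[\theta;\sigma]\Downarrow\mathtt{in}_i\,v'$ and $t_i[\theta;\sigma,v'/x_i]\Downarrow v$; $\mathtt{unpack}\,t\,\mathtt{as}\,(u,x)\,\mathtt{in}\,s$ evaluates to $v$ if $t[\theta;\sigma]\Downarrow\mathtt{pack}(N,v')$ and $s[\theta,N/u;\sigma,v'/x]\Downarrow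 v$; $(\mathtt{eq}\,s\,\mathtt{with}\,(\Delta.\Theta\mapsto t))[\theta;\sigma]\Downarrow v$ if $s[\theta;\sigma]\Downarrow\mathtt{refl}$, $\Delta\vdash\Theta\doteq\theta\searrow(\cdot\mid\theta')$ and $t[\theta';\sigma]\Downarrow v$; $(\mathtt{out}_l\,t)[\theta;\sigma]\Downarrow v$ if $t[\theta;\sigma]\Downarrow\mathtt{in}_l\,v$; $(\mathtt{out}_\nu\,t)[\theta;\sigma]\Downarrow w$ if $t[\theta;\sigma]\Downarrow c$ and $c\cdot_{\mathtt{out}_\nu}\Downarrow w$; $(t\,\vec M\,s)[\theta;\sigma]\Downarrow w$ if $t[\theta;\sigma]\Downarrow c$, $s[\theta;\sigma]\Downarrow v$ and $c\cdot\overrightarrow{M[\theta]}\,v\Downarrow w$. There is no rule for $\mathtt{eq\_abort}$. (b) $(\lambda\vec u,x.t)[\theta;\sigma]\cdot\vec N\,v\Downarrow w$ if $t[\theta,\overrightarrow{N/u};\sigma,v/x]\Downarrow w$; $(\mathtt{rec}\,f.t)[\theta;\sigma]\cdot\vec N\,(\mathtt{in}_\mu\,v)\Downarrow w$ if $t[\theta;\sigma,(\mathtt{rec}\,f.t)[\theta;\sigma]/f]\Downarrow c$ and $c\cdot\vec N\,v\Downarrow w$; $(\mathtt{corec}\,f.t)[\theta;\sigma]\cdot\vec N\,v$ evaluates to the closure $(\mathtt{corec}\,f.t)[\theta;\sigma]\cdot\vec N\,v$; $(\mathtt{ind}(t_0,u,f.t_s))[\theta;\sigma]\cdot0\,\langle\rangle\Downarrow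 w$ if $t_0[\theta;\sigma]\Downarrow w$; $(\mathtt{ind}(t_0,u,f.t_s))[\theta;\sigma]\cdot(\mathsf{suc}\,N)\,\langle\rangle\Downarrow w$ if $(\mathtt{ind}(t_0,u,f.t_s))[\theta;\sigma]\cdot N\,\langle\rangle\Downarrow v$ and $t_s[\theta,N/u;\sigma,v/f]\Downarrow w$. (c) $((\mathtt{corec}\,f.t)[\theta;\sigma]\cdot\vec N\,v)\cdot_{\mathtt{out}_\nu}\Downarrow w$ if $t[\theta;\sigma,(\mathtt{corec}\,f.t)[\theta;\sigma]/f]\Downarrow c$ and $c\cdot\vec N\,v\Downarrow w$. INTERPRETATION. $\Omega$ is the set of all values, $\mathcal P(\Omega)$ its power set. $[\![U]\!](\theta)=\{M\mid\cdot\vdash M:U[\theta]\}$; $[\![(\cdot)]\!](\theta)=\{\cdot\}$; $[\![(u_0{:}U_0,\overrightarrow{u{:}U})]\!](\theta)=\{M_0,\vec M\mid M_0\in[\![U_0]\!](\theta),\ \vec M\in[\![(\overrightarrow{u{:}U})]\!](\theta,M_0/u_0)\}$. $[\![*]\!](\theta)=\mathcal P(\Omega)$; $[\![\Pi u{:}U.K]\!](\theta)$ is the set of functions $\mathcal C$ with $\mathcal C(M)\in[\![K]\!](\theta,M/u)$ for all $M\in[\![U]\!](\theta)$; each $[\![K]\!](\theta)$ is a complete lattice (subset order lifted pointwise). For a complete lattice $\mathcal L$ and any $\mathcal F:\mathcal L\to\mathcal L$ put $\boldsymbol\mu\mathcal F=\bigwedge\{\mathcal C\in\mathcal L\mid\forall\mathcal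 X\in\mathcal L.\ \mathcal X\le\mathcal C\Rightarrow\mathcal F(\mathcal X)\le\mathcal C\}$ and $\boldsymbol\nu\mathcal F=\bigvee\{\mathcal C\in\mathcal L\mid\forall\mathcal X\in\mathcal L.\ \mathcal C\le\mathcal X\Rightarrow\mathcal C\le\mathcal F(\mathcal X)\}$. For a set $\vec{\mathcal U}$ of spines and $\mathcal A,\mathcal B:\vec{\mathcal U}\to\mathcal P(\Omega)$, $(\vec{\mathcal U},\mathcal A\to\mathcal B)$ is the set of closures $c$ such that for all $\vec M\in\vec{\mathcal U}$ and $v\in\mathcal A(\vec M)$ there is $w\in\mathcal B(\vec M)$ with $c\cdot\vec M\,v\Downarrow w$. For a tag $\mathtt{in}$ and $\mathcal V\subseteq\Omega$, $\mathtt{in}\,\mathcal V=\{\mathtt{in}\,v\mid v\in\mathcal V\}$ and $\mathtt{out}_\nu\mathcal V=\{c\mid\exists w\in\mathcal V.\ c\cdot_{\mathtt{out}_\nu}\Downarrow w\}$; $\mathtt{in}^*,\mathtt{out}_\nu^*$ are their pointwise liftings to $[\![K]\!](\theta)$. $[\![\cdot]\!](\theta)=\{\cdot\}$, $[\![\Xi,X{:}K]\!](\theta)=\{\eta,\mathcal X/X\mid\eta\in[\![\Xi]\!](\theta),\mathcal X\in[\![K]\!](\theta)\}$. Types: $[\![1]\!](\theta;\eta)=\{\langle\rangle\}$; $[\![T_1\times T_2]\!](\theta;\eta)=\{\langle v_1,v_2\rangle\mid v_i\in[\![T_i]\!](\theta;\eta)\}$; $[\![T_1+T_2]\!](\theta;\eta)=\mathtt{in}_1[\![T_1]\!](\theta;\eta)\cup\mathtt{in}_2[\![T_2]\!](\theta;\eta)$;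 $[\![(\overrightarrow{u{:}U});T_1\to T_2]\!](\theta;\eta)=([\![(\overrightarrow{u{:}U})]\!](\theta),\mathcal T_1\to\mathcal T_2)$ with $\mathcal T_i(\vec M)=[\![T_i]\!](\theta,\overrightarrow{M/u};\eta)$; $[\![\Sigma u{:}U.T]\!](\theta;\eta)=\{\mathtt{pack}(M,v)\mid M\in[\![U]\!](\theta),v\in[\![T]\!](\theta,M/u;\eta)\}$; $[\![T\,M]\!](\theta;\eta)=[\![T]\!](\theta;\eta)(M[\theta])$; $[\![M=N]\!](\theta;\eta)=\{\mathtt{refl}\mid\ \vdash M[\theta]=N[\theta]\}$; $[\![X]\!](\theta;\eta)=\eta(X)$; $[\![\Lambda u.T]\!](\theta;\eta)=(M\mapsto[\![T]\!](\theta,M/u;\eta))$; $[\![\mu X{:}K.T]\!](\theta;\eta)=\boldsymbol\mu(\mathcal X\mapsto\mathtt{in}_\mu^*[\![T]\!](\theta;\eta,\mathcal X/X))$ and $[\![\nu X{:}K.T]\!](\theta;\eta)=\boldsymbol\nu(\mathcal X\mapsto\mathtt{out}_\nu^*[\![T]\!](\theta;\eta,\mathcal X/X))$ in the lattice $[\![K]\!](\theta)$; $[\![\mathsf{Rec}_K(0\mapsto T_0\mid\mathsf{suc}\,u,X\mapsto T_s)]\!](\theta;\eta)$ is the function $\mathcal R$ on numerals with $\mathcal R(0)=\mathtt{in}_0^*[\![T_0]\!](\theta;\eta)$ and $\mathcal R(\mathsf{suc}\,N)=\mathtt{in}_{\mathsf{suc}}^*[\![T_s]\!](\theta,N/u;\eta,\mathcal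 R(N)/X)$. Typing contexts: $[\![\cdot]\!](\theta;\eta)=\{\cdot\}$, $[\![\Gamma,x{:}T]\!](\theta;\eta)=\{\sigma,v/x\mid\sigma\in[\![\Gamma]\!](\theta;\eta),v\in[\![T]\!](\theta;\eta)\}$. *)

(* Defs.v *)
From Stdlib Require Import List Arith ClassicalEpsilon.
Import ListNotations.
Set Implicit Arguments.

(** * Index language *)

(** Index variables are de Bruijn indices.  Contexts, substitutions and
    environments are lists whose head is the most recently added entry, so
    [Δ, u:U] is [U :: Δ] and [Θ, M/u] is [M :: Θ].  Index equality is syntactic,
    hence Leibniz equality, and has no judgment of its own. *)
Record index_sig : Type := IndexSig {
  itm : Type;
  ity : Type;
  ivar : nat -> itm;
  izero : itm;
  isuc : itm -> itm;
  inat : ity;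
  isub : (nat -> itm) -> itm -> itm;
  iusub : (nat -> itm) -> ity -> ity;
  itype : list ity -> ity -> Prop;
  ityping : list ity -> itm -> ity -> Prop;
  (** [iunify Δ M N P]; the result # is [None]. *)
  iunify : list ity -> itm -> itm -> option (list ity * list itm) -> Prop;
  (** [imatch Δ1 Θ1 Θ2 Δ2 Θ] is [Δ1 ⊢ Θ1 ≐ Θ2 ↘ (Δ2 | Θ)]. *)
  imatch : list ity -> list itm -> list itm -> list ity -> list itm -> Prop;
  imatch_tm : list ity -> itm -> itm -> list ity -> list itm -> Prop
}.

Arguments ivar {_}.
Arguments izero {_}.
Arguments isuc {_}.
Arguments inat {_}.
Arguments isub {_}.
Arguments iusub {_}.
Arguments itype {_}.
Arguments ityping {_}.
Arguments iunify {_}.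
Arguments imatch {_}.
Arguments imatch_tm {_}.

Definition ictx (L : index_sig) : Type := list (ity L).
Definition isubst (L : index_sig) : Type := list (itm L).

Section IndexDefs.
Context {L : index_sig}.

Definition scat (Θ : isubst L) (s : nat -> itm L) : nat -> itm L :=
  fun i => match nth_error Θ i with Some M => M | None => s (i - length Θ) end.

(** A simultaneous substitution whose domain is an entire context.  Variables
    outside of the domain do not occur in well-scoped expressions; sending them
    to [0] makes [lsub] commute with composition on raw expressions too. *)
Definition lsub (Θ : isubst L) : nat -> itm L := scat Θ (fun _ => izero).

(** Substitution for the innermost variables only, leaving the others alone.
    The spine [Ms] is listed outermost variable first. *)
Definition inst (Ms : list (itm L)) : nat -> itm L := scat (rev Ms) ivar.

Definition ishift (k : nat) : nat -> itm L := fun i => ivar (k + i).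

Definition up (s : nat -> itm L) : nat -> itm L :=
  fun i => match i with 0 => ivar 0 | S j => isub (ishift 1) (s j) end.

Definition upn (k : nat) (s : nat -> itm L) : nat -> itm L := Nat.iter k up s.

Definition icomp (Θ1 Θ2 : isubst L) : isubst L := map (isub (lsub Θ2)) Θ1.

Fixpoint num (n : nat) : itm L :=
  match n with 0 => izero | S m => isuc (num m) end.

Inductive wf_ictx : ictx L -> Prop :=
| wf_ictx_nil : wf_ictx []
| wf_ictx_cons Δ U : wf_ictx Δ -> itype Δ U -> wf_ictx (U :: Δ).

Inductive subty (Δ' : ictx L) : isubst L -> ictx L -> Prop :=
| subty_nil : subty Δ' [] []
| subty_cons Θ Δ M U :
    subty Δ' Θ Δ -> ityping Δ' M (iusub (lsub Θ) U) ->
    subty Δ' (M :: Θ) (U :: Δ).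

(** Spines and their types are listed outermost variable first, so
    [Δ, (u:U)] is [rev Us ++ Δ] and [θ, M/u] is [rev Ms ++ θ]. *)
Inductive itele : ictx L -> list (ity L) -> Prop :=
| itele_nil Δ : itele Δ []
| itele_cons Δ U Us : itype Δ U -> itele (U :: Δ) Us -> itele Δ (U :: Us).

Fixpoint telsub (s : nat -> itm L) (Us : list (ity L)) : list (ity L) :=
  match Us with [] => [] | U :: Us' => iusub s U :: telsub (up s) Us' end.

Inductive spine (Δ : ictx L) : list (itm L) -> list (ity L) -> Prop :=
| spine_nil : spine Δ [] []
| spine_cons M Ms U Us :
    ityping Δ M U -> spine Δ Ms (telsub (inst [M]) Us) ->
    spine Δ (M :: Ms) (U :: Us).

(** The index variables bound by a telescope of length [k], outermost first. *)
Definition ivars (k : nat) : list (itm L) := map ivar (rev (seq 0 k)).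

End IndexDefs.

Record index_laws (L : index_sig) : Type := IndexLaws {
  isub_ivar : forall s i, isub s (ivar i) = s i :> itm L;
  isub_id : forall M : itm L, isub ivar M = M;
  iusub_id : forall U : ity L, iusub ivar U = U;
  isub_isub : forall s1 s2 (M : itm L),
    isub s2 (isub s1 M) = isub (fun i => isub s2 (s1 i)) M;
  iusub_iusub : forall s1 s2 (U : ity L),
    iusub s2 (iusub s1 U) = iusub (fun i => isub s2 (s1 i)) U;
  ityping_ivar : forall (Δ : ictx L) i U, nth_error Δ i = Some U ->
    ityping Δ (ivar i) (iusub (ishift (S i)) U);

  isub_izero : forall s, isub s izero = izero :> itm L;
  isub_isuc : forall s (M : itm L), isub s (isuc M) = isuc (isub s M);
  iusub_inat : forall s, iusub s inat = inat :> ity L;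
  izero_isuc : forall M : itm L, izero <> isuc M;
  isuc_inj : forall M N : itm L, isuc M = isuc N -> M = N;
  itype_inat : forall Δ : ictx L, itype Δ inat;
  ityping_izero : forall Δ : ictx L, ityping Δ izero inat;
  ityping_isuc : forall (Δ : ictx L) M,
    ityping Δ M inat -> ityping Δ (isuc M) inat;
  ityping_inat_closed : forall M : itm L,
    ityping [] M inat <-> exists n, M = num n;

  itm_eq_dec : forall M N : itm L, {M = N} + {M <> N};
  ityping_dec : forall (Δ : ictx L) M U, {ityping Δ M U} + {~ ityping Δ M U};

  itype_inst : forall (Δ : ictx L) V N U,
    itype (V :: Δ) U -> ityping Δ N V -> itype Δ (iusub (inst [N]) U);
  ityping_inst : forall (Δ : ictx L) V N M U,
    ityping (V :: Δ) M U -> ityping Δ N V ->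
    ityping Δ (isub (inst [N]) M) (iusub (inst [N]) U);
  itype_lsub : forall (Δ Δ' : ictx L) Θ U,
    itype Δ U -> subty Δ' Θ Δ -> itype Δ' (iusub (lsub Θ) U);
  ityping_lsub : forall (Δ Δ' : ictx L) Θ M U,
    ityping Δ M U -> subty Δ' Θ Δ ->
    ityping Δ' (isub (lsub Θ) M) (iusub (lsub Θ) U);

  iunify_dec : forall (Δ : ictx L) M N U,
    wf_ictx Δ -> ityping Δ M U -> ityping Δ N U -> {P | iunify Δ M N P};
  iunify_unique : forall (Δ : ictx L) M N U P P',
    wf_ictx Δ -> ityping Δ M U -> ityping Δ N U ->
    iunify Δ M N P -> iunify Δ M N P' -> P = P';
  iunify_unifier : forall (Δ : ictx L) M N U Δ' Θ,
    wf_ictx Δ -> ityping Δ M U -> ityping Δ N U ->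
    iunify Δ M N (Some (Δ', Θ)) ->
    wf_ictx Δ' /\ subty Δ' Θ Δ /\ isub (lsub Θ) M = isub (lsub Θ) N;
  iunify_most_general : forall (Δ : ictx L) M N U Δ' Θ Δ'' Θ'',
    wf_ictx Δ -> ityping Δ M U -> ityping Δ N U ->
    iunify Δ M N (Some (Δ', Θ)) ->
    wf_ictx Δ'' -> subty Δ'' Θ'' Δ -> isub (lsub Θ'') M = isub (lsub Θ'') N ->
    exists Θ0, subty Δ'' Θ0 Δ' /\ Θ'' = icomp Θ Θ0;
  iunify_fail : forall (Δ : ictx L) M N U Δ'' Θ'',
    wf_ictx Δ -> ityping Δ M U -> ityping Δ N U ->
    iunify Δ M N None ->
    wf_ictx Δ'' -> subty Δ'' Θ'' Δ -> isub (lsub Θ'') M <> isub (lsub Θ'') N;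

  imatch_sound : forall (Δ Δ1 Δ2 : ictx L) Θ1 Θ2 Θ,
    subty Δ1 Θ1 Δ -> imatch Δ1 Θ1 Θ2 Δ2 Θ ->
    subty Δ2 Θ Δ1 /\ icomp Θ1 Θ = Θ2;
  imatch_tm_sound : forall (Δ1 Δ2 : ictx L) M1 M2 U Θ,
    ityping Δ1 M1 U -> imatch_tm Δ1 M1 M2 Δ2 Θ ->
    subty Δ2 Θ Δ1 /\ isub (lsub Θ) M1 = M2;
  imatch_complete : forall (Δ : ictx L) M N U Δ' Θ θ,
    wf_ictx Δ -> ityping Δ M U -> ityping Δ N U ->
    subty [] θ Δ -> isub (lsub θ) M = isub (lsub θ) N ->
    iunify Δ M N (Some (Δ', Θ)) ->
    exists θ', imatch Δ' Θ θ [] θ'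
}.

(** * Types

    Type variables are locally nameless: those declared in a context [Ξ] are
    names ([TFVar]), those bound by μ, ν or Rec are de Bruijn indices ([TBVar]).
    A term can thus be checked unchanged under an extension of [Ξ]. *)

Definition name : Type := nat.

Section Tores.
Context {L : index_sig}.

Inductive kind : Type :=
| KStar
| KPi (U : ity L) (K : kind).

(** [TArr Us S T] binds [length Us] index variables in [S] and [T]; [TSig] and
    [TLam] bind one in [T]; [TMu] and [TNu] bind a type variable in [T];
    [TRec] binds an index variable and a type variable in [Ts]. *)
Inductive ty : Type :=
| TUnit
| TProd (T1 T2 : ty)
| TSum (T1 T2 : ty)
| TArr (Us : list (ity L)) (S T : ty)
| TSig (U : ity L) (T : ty)
| TEq (M N : itm L)
| TApp (T : ty) (M : itm L)
| TLam (T : ty)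
| TFVar (X : name)
| TBVar (i : nat)
| TMu (K : kind) (T : ty)
| TNu (K : kind) (T : ty)
| TRec (K : kind) (T0 Ts : ty).

Fixpoint ksub (s : nat -> itm L) (K : kind) : kind :=
  match K with
  | KStar => KStar
  | KPi U K => KPi (iusub s U) (ksub (up s) K)
  end.

Fixpoint tysub (s : nat -> itm L) (T : ty) : ty :=
  match T with
  | TUnit => TUnit
  | TProd T1 T2 => TProd (tysub s T1) (tysub s T2)
  | TSum T1 T2 => TSum (tysub s T1) (tysub s T2)
  | TArr Us T1 T2 =>
      TArr (telsub s Us) (tysub (upn (length Us) s) T1)
           (tysub (upn (length Us) s) T2)
  | TSig U T => TSig (iusub s U) (tysub (up s) T)
  | TEq M N => TEq (isub s M) (isub s N)
  | TApp T M => TApp (tysub s T) (isub s M)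
  | TLam T => TLam (tysub (up s) T)
  | TFVar X => TFVar X
  | TBVar i => TBVar i
  | TMu K T => TMu (ksub s K) (tysub s T)
  | TNu K T => TNu (ksub s K) (tysub s T)
  | TRec K T0 Ts => TRec (ksub s K) (tysub s T0) (tysub (up s) Ts)
  end.

(** [topen k R T] replaces the bound type variable [k] of [T] by the locally
    closed type [R], whose index variables are shifted under index binders. *)
Fixpoint topen (k : nat) (R T : ty) : ty :=
  match T with
  | TUnit => TUnit
  | TProd T1 T2 => TProd (topen k R T1) (topen k R T2)
  | TSum T1 T2 => TSum (topen k R T1) (topen k R T2)
  | TArr Us T1 T2 =>
      let R' := tysub (ishift (length Us)) R in
      TArr Us (topen k R' T1) (topen k R' T2)
  | TSig U T => TSig U (topen k (tysub (ishift 1) R) T)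
  | TEq M N => TEq M N
  | TApp T M => TApp (topen k R T) M
  | TLam T => TLam (topen k (tysub (ishift 1) R) T)
  | TFVar X => TFVar X
  | TBVar i => if Nat.eqb i k then R else TBVar i
  | TMu K T => TMu K (topen (S k) R T)
  | TNu K T => TNu K (topen (S k) R T)
  | TRec K T0 Ts =>
      TRec K (topen k R T0) (topen (S k) (tysub (ishift 1) R) Ts)
  end.

Fixpoint ftv (T : ty) : list name :=
  match T with
  | TUnit | TEq _ _ | TBVar _ => []
  | TProd T1 T2 | TSum T1 T2 | TArr _ T1 T2 => ftv T1 ++ ftv T2
  | TSig _ T | TApp T _ | TLam T | TMu _ T | TNu _ T => ftv T
  | TFVar X => [X]
  | TRec _ T0 Ts => ftv T0 ++ ftv Ts
  end.

Definition tapps (T : ty) (Ms : list (itm L)) : ty := fold_left TApp Ms T.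
Definition tlams (k : nat) (T : ty) : ty := Nat.iter k TLam T.
Definition kpis (Us : list (ity L)) (K : kind) : kind := fold_right KPi K Us.

(** [T[M/u; R/X]], where [T] is under the index binders [u] and the type binder
    [X], and [R] is under neither. *)
Definition tunfold (T : ty) (Ms : list (itm L)) (R : ty) : ty :=
  tysub (inst Ms) (topen 0 (tysub (ishift (length Ms)) R) T).

(** The identification of applied lambdas with their contracta; it is imposed
    on the judgments below through conversion rules. *)
Inductive teq : ty -> ty -> Prop :=
| teq_beta T M : teq (TApp (TLam T) M) (tysub (inst [M]) T)
| teq_refl T : teq T T
| teq_sym T T' : teq T T' -> teq T' T
| teq_trans T T' T'' : teq T T' -> teq T' T'' -> teq T T''
| teq_prod T1 T2 T1' T2' :
    teq T1 T1' -> teq T2 T2' -> teq (TProd T1 T2) (TProd T1' T2')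
| teq_sum T1 T2 T1' T2' :
    teq T1 T1' -> teq T2 T2' -> teq (TSum T1 T2) (TSum T1' T2')
| teq_arr Us S T S' T' :
    teq S S' -> teq T T' -> teq (TArr Us S T) (TArr Us S' T')
| teq_sig U T T' : teq T T' -> teq (TSig U T) (TSig U T')
| teq_app T T' M : teq T T' -> teq (TApp T M) (TApp T' M)
| teq_lam T T' : teq T T' -> teq (TLam T) (TLam T')
| teq_mu K T T' : teq T T' -> teq (TMu K T) (TMu K T')
| teq_nu K T T' : teq T T' -> teq (TNu K T) (TNu K T')
| teq_rec K T0 Ts T0' Ts' :
    teq T0 T0' -> teq Ts Ts' -> teq (TRec K T0 Ts) (TRec K T0' Ts').

Definition tvctx : Type := list (name * kind).
Definition ctx : Type := list ty.

Definition tvsub (s : nat -> itm L) (Ξ : tvctx) : tvctx :=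
  map (fun p => (fst p, ksub s (snd p))) Ξ.
Definition ctxsub (s : nat -> itm L) (Γ : ctx) : ctx := map (tysub s) Γ.

Inductive wf_kind : ictx L -> kind -> Prop :=
| wf_kstar Δ : wf_kind Δ KStar
| wf_kpi Δ U K : itype Δ U -> wf_kind (U :: Δ) K -> wf_kind Δ (KPi U K).

(** The [wf_kind] premises express that annotations are presupposed to be
    well-formed. *)
Inductive kcheck : ictx L -> tvctx -> ty -> kind -> Prop :=
| kc_unit Δ Ξ : kcheck Δ Ξ TUnit KStar
| kc_prod Δ Ξ T1 T2 :
    kcheck Δ Ξ T1 KStar -> kcheck Δ Ξ T2 KStar ->
    kcheck Δ Ξ (TProd T1 T2) KStar
| kc_sum Δ Ξ T1 T2 :
    kcheck Δ Ξ T1 KStar -> kcheck Δ Ξ T2 KStar ->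
    kcheck Δ Ξ (TSum T1 T2) KStar
| kc_arr Δ Ξ Us S T :
    itele Δ Us ->
    kcheck (rev Us ++ Δ) (tvsub (ishift (length Us)) Ξ) S KStar ->
    kcheck (rev Us ++ Δ) (tvsub (ishift (length Us)) Ξ) T KStar ->
    kcheck Δ Ξ (TArr Us S T) KStar
| kc_sig Δ Ξ U T :
    itype Δ U -> kcheck (U :: Δ) (tvsub (ishift 1) Ξ) T KStar ->
    kcheck Δ Ξ (TSig U T) KStar
| kc_eq Δ Ξ M N U :
    ityping Δ M U -> ityping Δ N U -> kcheck Δ Ξ (TEq M N) KStar
| kc_lam Δ Ξ U T K :
    kcheck (U :: Δ) (tvsub (ishift 1) Ξ) T K ->
    kcheck Δ Ξ (TLam T) (KPi U K)
| kc_synth Δ Ξ T : ksynth Δ Ξ T KStar -> kcheck Δ Ξ T KStar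
| kc_conv Δ Ξ T T' K : teq T T' -> kcheck Δ Ξ T' K -> kcheck Δ Ξ T K

with ksynth : ictx L -> tvctx -> ty -> kind -> Prop :=
| ks_var Δ Ξ X K : In (X, K) Ξ -> ksynth Δ Ξ (TFVar X) K
| ks_app Δ Ξ T U K M :
    ksynth Δ Ξ T (KPi U K) -> ityping Δ M U ->
    ksynth Δ Ξ (TApp T M) (ksub (inst [M]) K)
| ks_mu Δ Ξ K T X :
    wf_kind Δ K -> ~ In X (map fst Ξ) -> ~ In X (ftv T) ->
    kcheck Δ ((X, K) :: Ξ) (topen 0 (TFVar X) T) K ->
    ksynth Δ Ξ (TMu K T) K
| ks_nu Δ Ξ K T X :
    wf_kind Δ K -> ~ In X (map fst Ξ) -> ~ In X (ftv T) ->
    kcheck Δ ((X, K) :: Ξ) (topen 0 (TFVar X) T) K ->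
    ksynth Δ Ξ (TNu K T) K
| ks_rec Δ Ξ K' T0 Ts X :
    wf_kind Δ (KPi inat K') -> ~ In X (map fst Ξ) -> ~ In X (ftv Ts) ->
    kcheck Δ Ξ T0 (ksub (inst [izero]) K') ->
    kcheck (inat :: Δ) ((X, K') :: tvsub (ishift 1) Ξ)
           (topen 0 (TFVar X) Ts)
           (ksub (scat [isuc (ivar 0)] (ishift 1)) K') ->
    ksynth Δ Ξ (TRec (KPi inat K') T0 Ts) (KPi inat K')
| ks_conv Δ Ξ T T' K : teq T T' -> ksynth Δ Ξ T' K -> ksynth Δ Ξ T K.

Definition presup (Δ : ictx L) (Ξ : tvctx) (Γ : ctx) (T : ty) : Prop :=
  wf_ictx Δ /\
  (NoDup (map fst Ξ) /\ Forall (fun p => wf_kind Δ (snd p)) Ξ) /\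
  Forall (fun S => kcheck Δ Ξ S KStar) Γ /\
  kcheck Δ Ξ T KStar.

(** * Terms *)

Inductive itag : Type := in1 | in2.
Inductive ltag : Type := l_zero | l_suc.

(** Term variables are de Bruijn indices.  [fn] is the syntactic category of
    function values; [GLam k t] binds [k] index variables and a term variable.  In
    [EqWith s Δ Θ t] the context [Δ] replaces the ambient one: it binds all the
    index variables of [Θ] and [t]. *)
Inductive tm : Type :=
| Var (x : nat)
| Unit
| Fn (g : fn)
| App (t : tm) (Ms : list (itm L)) (s : tm)
| Pair (t1 t2 : tm)
| Split (s t : tm)
| In_ (i : itag) (t : tm)
| Case (t t1 t2 : tm)
| Pack (M : itm L) (t : tm)
| Unpack (t s : tm)
| Refl
| EqWith (s : tm) (Δ : ictx L) (Θ : isubst L) (t : tm)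
| EqAbort (s : tm)
| InMu (t : tm)
| OutNu (t : tm)
| InL (l : ltag) (t : tm)
| OutL (l : ltag) (t : tm)
| Ann (t : tm) (T : ty)
with fn : Type :=
| GLam (k : nat) (t : tm)
| GRec (t : tm)
| GCorec (t : tm)
| GInd (t0 ts : tm).

Fixpoint ftv_tm (t : tm) : list name :=
  match t with
  | Var _ | Unit | Refl => []
  | Fn g => ftv_fn g
  | App t _ s => ftv_tm t ++ ftv_tm s
  | Pair t1 t2 => ftv_tm t1 ++ ftv_tm t2
  | Split s t => ftv_tm s ++ ftv_tm t
  | In_ _ t | Pack _ t | EqAbort t | InMu t | OutNu t | InL _ t | OutL _ t =>
      ftv_tm t
  | Case t t1 t2 => ftv_tm t ++ ftv_tm t1 ++ ftv_tm t2
  | Unpack t s => ftv_tm t ++ ftv_tm s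
  | EqWith s _ _ t => ftv_tm s ++ ftv_tm t
  | Ann t T => ftv_tm t ++ ftv T
  end
with ftv_fn (g : fn) : list name :=
  match g with
  | GLam _ t | GRec t | GCorec t => ftv_tm t
  | GInd t0 ts => ftv_tm t0 ++ ftv_tm ts
  end.

Definition fresh (X : name) (Ξ : tvctx) (Γ : ctx) (t : tm) (T : ty) : Prop :=
  ~ In X (map fst Ξ) /\ ~ In X (flat_map ftv Γ) /\
  ~ In X (ftv_tm t) /\ ~ In X (ftv T).

(** In [ck_rec] and [ck_corec] the fixed point type is formed in [Δ] and
    shifted under the index variables [u] of the function type. *)
Inductive check : ictx L -> tvctx -> ctx -> tm -> ty -> Prop :=
| ck_unit Δ Ξ Γ : presup Δ Ξ Γ TUnit -> check Δ Ξ Γ Unit TUnit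
| ck_pair Δ Ξ Γ t1 t2 T1 T2 :
    presup Δ Ξ Γ (TProd T1 T2) ->
    check Δ Ξ Γ t1 T1 -> check Δ Ξ Γ t2 T2 ->
    check Δ Ξ Γ (Pair t1 t2) (TProd T1 T2)
| ck_split Δ Ξ Γ p t T1 T2 T :
    presup Δ Ξ Γ T ->
    synth Δ Ξ Γ p (TProd T1 T2) -> check Δ Ξ (T2 :: T1 :: Γ) t T ->
    check Δ Ξ Γ (Split p t) T
| ck_in1 Δ Ξ Γ t T1 T2 :
    presup Δ Ξ Γ (TSum T1 T2) -> check Δ Ξ Γ t T1 ->
    check Δ Ξ Γ (In_ in1 t) (TSum T1 T2)
| ck_in2 Δ Ξ Γ t T1 T2 :
    presup Δ Ξ Γ (TSum T1 T2) -> check Δ Ξ Γ t T2 ->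
    check Δ Ξ Γ (In_ in2 t) (TSum T1 T2)
| ck_case Δ Ξ Γ t t1 t2 T1 T2 S :
    presup Δ Ξ Γ S ->
    synth Δ Ξ Γ t (TSum T1 T2) ->
    check Δ Ξ (T1 :: Γ) t1 S -> check Δ Ξ (T2 :: Γ) t2 S ->
    check Δ Ξ Γ (Case t t1 t2) S
| ck_pack Δ Ξ Γ M t U T :
    presup Δ Ξ Γ (TSig U T) ->
    ityping Δ M U -> check Δ Ξ Γ t (tysub (inst [M]) T) ->
    check Δ Ξ Γ (Pack M t) (TSig U T)
| ck_unpack Δ Ξ Γ t s U T S :
    presup Δ Ξ Γ S ->
    synth Δ Ξ Γ t (TSig U T) ->
    check (U :: Δ) (tvsub (ishift 1) Ξ) (T :: ctxsub (ishift 1) Γ) s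
          (tysub (ishift 1) S) ->
    check Δ Ξ Γ (Unpack t s) S
| ck_refl Δ Ξ Γ M N :
    presup Δ Ξ Γ (TEq M N) -> M = N -> check Δ Ξ Γ Refl (TEq M N)
| ck_eqabort Δ Ξ Γ s M N T :
    presup Δ Ξ Γ T ->
    synth Δ Ξ Γ s (TEq M N) -> iunify Δ M N None ->
    check Δ Ξ Γ (EqAbort s) T
| ck_eqwith Δ Ξ Γ s Δ' Θ t M N T :
    presup Δ Ξ Γ T ->
    synth Δ Ξ Γ s (TEq M N) -> iunify Δ M N (Some (Δ', Θ)) ->
    check Δ' (tvsub (lsub Θ) Ξ) (ctxsub (lsub Θ) Γ) t (tysub (lsub Θ) T) ->
    check Δ Ξ Γ (EqWith s Δ' Θ t) T
| ck_lam Δ Ξ Γ Us S T t :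
    presup Δ Ξ Γ (TArr Us S T) ->
    check (rev Us ++ Δ) (tvsub (ishift (length Us)) Ξ)
          (S :: ctxsub (ishift (length Us)) Γ) t T ->
    check Δ Ξ Γ (Fn (GLam (length Us) t)) (TArr Us S T)
| ck_inmu Δ Ξ Γ t K T Ms :
    let R := TMu K (tlams (length Ms) T) in
    presup Δ Ξ Γ (tapps R Ms) ->
    check Δ Ξ Γ t (tunfold T Ms R) ->
    check Δ Ξ Γ (InMu t) (tapps R Ms)
| ck_rec Δ Ξ Γ t Us S T X :
    let k := length Us in
    let K := kpis Us KStar in
    let R := TMu K (tlams k S) in
    let A := TArr Us (tapps (tysub (ishift k) R) (ivars k)) T in
    presup Δ Ξ Γ A ->
    fresh X Ξ Γ t A ->
    check Δ ((X, K) :: Ξ) (TArr Us (tapps (TFVar X) (ivars k)) T :: Γ) t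
          (TArr Us (topen 0 (TFVar X) S) T) ->
    check Δ Ξ Γ (Fn (GRec t)) A
| ck_corec Δ Ξ Γ t Us S T X :
    let k := length Us in
    let K := kpis Us KStar in
    let R := TNu K (tlams k T) in
    let A := TArr Us S (tapps (tysub (ishift k) R) (ivars k)) in
    presup Δ Ξ Γ A ->
    fresh X Ξ Γ t A ->
    check Δ ((X, K) :: Ξ) (TArr Us S (tapps (TFVar X) (ivars k)) :: Γ) t
          (TArr Us S (topen 0 (TFVar X) T)) ->
    check Δ Ξ Γ (Fn (GCorec t)) A
| ck_ind Δ Ξ Γ t0 ts T :
    presup Δ Ξ Γ (TArr [inat] TUnit T) ->
    check Δ Ξ Γ t0 (tysub (inst [izero]) T) ->
    check (inat :: Δ) (tvsub (ishift 1) Ξ) (T :: ctxsub (ishift 1) Γ) ts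
          (tysub (scat [isuc (ivar 0)] (ishift 1)) T) ->
    check Δ Ξ Γ (Fn (GInd t0 ts)) (TArr [inat] TUnit T)
| ck_inzero Δ Ξ Γ t K T0 Ts Ms :
    presup Δ Ξ Γ (tapps (TApp (TRec K T0 Ts) izero) Ms) ->
    check Δ Ξ Γ t (tapps T0 Ms) ->
    check Δ Ξ Γ (InL l_zero t) (tapps (TApp (TRec K T0 Ts) izero) Ms)
| ck_insuc Δ Ξ Γ t K T0 Ts N Ms :
    let R := TRec K T0 Ts in
    presup Δ Ξ Γ (tapps (TApp R (isuc N)) Ms) ->
    check Δ Ξ Γ t (tapps (tunfold Ts [N] (TApp R N)) Ms) ->
    check Δ Ξ Γ (InL l_suc t) (tapps (TApp R (isuc N)) Ms)
| ck_synth Δ Ξ Γ t T :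
    presup Δ Ξ Γ T -> synth Δ Ξ Γ t T -> check Δ Ξ Γ t T
| ck_conv Δ Ξ Γ t T T' :
    presup Δ Ξ Γ T -> teq T T' -> check Δ Ξ Γ t T' -> check Δ Ξ Γ t T

with synth : ictx L -> tvctx -> ctx -> tm -> ty -> Prop :=
| sy_var Δ Ξ Γ x T :
    presup Δ Ξ Γ T -> nth_error Γ x = Some T -> synth Δ Ξ Γ (Var x) T
| sy_app Δ Ξ Γ t Ms s Us S T :
    presup Δ Ξ Γ (tysub (inst Ms) T) ->
    synth Δ Ξ Γ t (TArr Us S T) -> spine Δ Ms Us ->
    check Δ Ξ Γ s (tysub (inst Ms) S) ->
    synth Δ Ξ Γ (App t Ms s) (tysub (inst Ms) T)
| sy_outzero Δ Ξ Γ t K T0 Ts Ms :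
    presup Δ Ξ Γ (tapps T0 Ms) ->
    synth Δ Ξ Γ t (tapps (TApp (TRec K T0 Ts) izero) Ms) ->
    synth Δ Ξ Γ (OutL l_zero t) (tapps T0 Ms)
| sy_outsuc Δ Ξ Γ t K T0 Ts N Ms :
    let R := TRec K T0 Ts in
    presup Δ Ξ Γ (tapps (tunfold Ts [N] (TApp R N)) Ms) ->
    synth Δ Ξ Γ t (tapps (TApp R (isuc N)) Ms) ->
    synth Δ Ξ Γ (OutL l_suc t) (tapps (tunfold Ts [N] (TApp R N)) Ms)
| sy_outnu Δ Ξ Γ t K T Ms :
    let R := TNu K (tlams (length Ms) T) in
    presup Δ Ξ Γ (tunfold T Ms R) ->
    synth Δ Ξ Γ t (tapps R Ms) ->
    synth Δ Ξ Γ (OutNu t) (tunfold T Ms R)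
| sy_ann Δ Ξ Γ t T :
    presup Δ Ξ Γ T -> check Δ Ξ Γ t T -> synth Δ Ξ Γ (Ann t T) T
| sy_conv Δ Ξ Γ t T T' :
    presup Δ Ξ Γ T -> teq T T' -> synth Δ Ξ Γ t T' -> synth Δ Ξ Γ t T.

(** * Evaluation *)

Inductive val : Type :=
| VClos (c : closure)
| VUnit
| VPair (v1 v2 : val)
| VIn (i : itag) (v : val)
| VPack (M : itm L) (v : val)
| VRefl
| VInMu (v : val)
| VInL (l : ltag) (v : val)
with closure : Type :=
| CFn (g : fn) (θ : isubst L) (σ : list val)
(** [(corec f.t)[θ;σ] · Ns v] *)
| CCorec (t : tm) (θ : isubst L) (σ : list val) (Ns : list (itm L)) (v : val).

Definition env : Type := list val.

Inductive eval : tm -> isubst L -> env -> val -> Prop :=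
| ev_var x θ σ v : nth_error σ x = Some v -> eval (Var x) θ σ v
| ev_unit θ σ : eval Unit θ σ VUnit
| ev_refl θ σ : eval Refl θ σ VRefl
| ev_fn g θ σ : eval (Fn g) θ σ (VClos (CFn g θ σ))
| ev_pair t1 t2 θ σ v1 v2 :
    eval t1 θ σ v1 -> eval t2 θ σ v2 -> eval (Pair t1 t2) θ σ (VPair v1 v2)
| ev_in i t θ σ v : eval t θ σ v -> eval (In_ i t) θ σ (VIn i v)
| ev_inmu t θ σ v : eval t θ σ v -> eval (InMu t) θ σ (VInMu v)
| ev_inl l t θ σ v : eval t θ σ v -> eval (InL l t) θ σ (VInL l v)
| ev_pack M t θ σ v :
    eval t θ σ v -> eval (Pack M t) θ σ (VPack (isub (lsub θ) M) v)
| ev_ann t T θ σ v : eval t θ σ v -> eval (Ann t T) θ σ v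
| ev_split t s θ σ v1 v2 v :
    eval t θ σ (VPair v1 v2) -> eval s θ (v2 :: v1 :: σ) v ->
    eval (Split t s) θ σ v
| ev_case1 t t1 t2 θ σ v' v :
    eval t θ σ (VIn in1 v') -> eval t1 θ (v' :: σ) v ->
    eval (Case t t1 t2) θ σ v
| ev_case2 t t1 t2 θ σ v' v :
    eval t θ σ (VIn in2 v') -> eval t2 θ (v' :: σ) v ->
    eval (Case t t1 t2) θ σ v
| ev_unpack t s θ σ N v' v :
    eval t θ σ (VPack N v') -> eval s (N :: θ) (v' :: σ) v ->
    eval (Unpack t s) θ σ v
| ev_eqwith s Δ Θ t θ σ θ' v :
    eval s θ σ VRefl -> imatch Δ Θ θ [] θ' -> eval t θ' σ v ->
    eval (EqWith s Δ Θ t) θ σ v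
| ev_outl l t θ σ v : eval t θ σ (VInL l v) -> eval (OutL l t) θ σ v
| ev_outnu t θ σ c w :
    eval t θ σ (VClos c) -> eval_out c w -> eval (OutNu t) θ σ w
| ev_app t Ms s θ σ c v w :
    eval t θ σ (VClos c) -> eval s θ σ v ->
    eval_app c (map (isub (lsub θ)) Ms) v w ->
    eval (App t Ms s) θ σ w

with eval_app : closure -> list (itm L) -> val -> val -> Prop :=
| ea_lam k t θ σ Ns v w :
    length Ns = k -> eval t (rev Ns ++ θ) (v :: σ) w ->
    eval_app (CFn (GLam k t) θ σ) Ns v w
| ea_rec t θ σ Ns v c w :
    eval t θ (VClos (CFn (GRec t) θ σ) :: σ) (VClos c) ->
    eval_app c Ns v w ->
    eval_app (CFn (GRec t) θ σ) Ns (VInMu v) w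
| ea_corec t θ σ Ns v :
    eval_app (CFn (GCorec t) θ σ) Ns v (VClos (CCorec t θ σ Ns v))
| ea_ind_zero t0 ts θ σ w :
    eval t0 θ σ w -> eval_app (CFn (GInd t0 ts) θ σ) [izero] VUnit w
| ea_ind_suc t0 ts θ σ N v w :
    eval_app (CFn (GInd t0 ts) θ σ) [N] VUnit v ->
    eval ts (N :: θ) (v :: σ) w ->
    eval_app (CFn (GInd t0 ts) θ σ) [isuc N] VUnit w

with eval_out : closure -> val -> Prop :=
| eo_corec t θ σ Ns v c w :
    eval t θ (VClos (CFn (GCorec t) θ σ) :: σ) (VClos c) ->
    eval_app c Ns v w ->
    eval_out (CCorec t θ σ Ns v) w.

(** * Interpretation *)

Definition itypeI (U : ity L) (θ : isubst L) (M : itm L) : Prop :=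
  ityping [] M (iusub (lsub θ) U).

Fixpoint teleI (Us : list (ity L)) (θ : isubst L) (Ms : list (itm L)) : Prop :=
  match Us, Ms with
  | [], [] => True
  | U :: Us, M :: Ms => itypeI U θ M /\ teleI Us (M :: θ) Ms
  | _, _ => False
  end.

(** A universe containing all the sets [[K]](θ): subsets of Ω, and functions on
    index terms.  A function in [[Πu:U.K]](θ) is given on all index terms, but
    only its values on [[U]](θ) are subject to conditions ([kindI]) and compared
    ([kle]). *)
Inductive dom : Type :=
| DSet (P : val -> Prop)
| DFun (f : itm L -> dom).

Definition delem (C : dom) (v : val) : Prop :=
  match C with DSet P => P v | DFun _ => False end.

Definition dapp (C : dom) (M : itm L) : dom :=
  match C with DSet _ => DSet (fun _ => False) | DFun f => f M end.

(** Pointwise lifting of an operation on subsets of Ω. *)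
Fixpoint dlift (F : (val -> Prop) -> (val -> Prop)) (C : dom) : dom :=
  match C with
  | DSet P => DSet (F P)
  | DFun f => DFun (fun M => dlift F (f M))
  end.

Fixpoint kindI (K : kind) (θ : isubst L) (C : dom) : Prop :=
  match K with
  | KStar => exists P, C = DSet P
  | KPi U K => exists f, C = DFun f /\
      forall M, itypeI U θ M -> kindI K (M :: θ) (f M)
  end.

Fixpoint kle (K : kind) (θ : isubst L) (C D : dom) : Prop :=
  match K with
  | KStar => forall v, delem C v -> delem D v
  | KPi U K =>
      forall M, itypeI U θ M -> kle K (M :: θ) (dapp C M) (dapp D M)
  end.

Fixpoint kmeet (K : kind) (F : dom -> Prop) : dom :=
  match K with
  | KStar => DSet (fun v => forall C, F C -> delem C v)
  | KPi _ K => DFun (fun M => kmeet K (fun D => exists C, F C /\ D = dapp C M))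
  end.

Fixpoint kjoin (K : kind) (F : dom -> Prop) : dom :=
  match K with
  | KStar => DSet (fun v => exists C, F C /\ delem C v)
  | KPi _ K => DFun (fun M => kjoin K (fun D => exists C, F C /\ D = dapp C M))
  end.

Definition kmu (K : kind) (θ : isubst L) (F : dom -> dom) : dom :=
  kmeet K (fun C => kindI K θ C /\
    forall X, kindI K θ X -> kle K θ X C -> kle K θ (F X) C).

Definition knu (K : kind) (θ : isubst L) (F : dom -> dom) : dom :=
  kjoin K (fun C => kindI K θ C /\
    forall X, kindI K θ X -> kle K θ C X -> kle K θ C (F X)).

Definition tagS (tag : val -> val) (V : val -> Prop) : val -> Prop :=
  fun w => exists v, V v /\ w = tag v.

Definition outS (V : val -> Prop) : val -> Prop :=
  fun w => exists c, w = VClos c /\ exists w', V w' /\ eval_out c w'.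

(** The function on numerals given by a sequence of values; it is irrelevant
    elsewhere. *)
Definition dnum (R : nat -> dom) : dom :=
  DFun (fun N => R (epsilon (inhabits 0) (fun n => N = num n))).

Definition tvenv : Type := list (name * dom).

Fixpoint lookup (η : tvenv) (X : name) : dom :=
  match η with
  | [] => DSet (fun _ => False)
  | (Y, C) :: η => if Nat.eqb X Y then C else lookup η X
  end.

(** [β] interprets the bound type variables whose binder has been traversed; it
    is empty for the types occurring in the judgments. *)
Fixpoint interp (T : ty) (β : list dom) (θ : isubst L) (η : tvenv) : dom :=
  match T with
  | TUnit => DSet (fun v => v = VUnit)
  | TProd T1 T2 => DSet (fun v => exists v1 v2, v = VPair v1 v2 /\
      delem (interp T1 β θ η) v1 /\ delem (interp T2 β θ η) v2)
  | TSum T1 T2 => DSet (fun v =>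
      tagS (VIn in1) (delem (interp T1 β θ η)) v \/
      tagS (VIn in2) (delem (interp T2 β θ η)) v)
  | TArr Us T1 T2 => DSet (fun v => exists c, v = VClos c /\
      forall Ms a, teleI Us θ Ms -> delem (interp T1 β (rev Ms ++ θ) η) a ->
      exists w, delem (interp T2 β (rev Ms ++ θ) η) w /\ eval_app c Ms a w)
  | TSig U T => DSet (fun v => exists M v', v = VPack M v' /\
      itypeI U θ M /\ delem (interp T β (M :: θ) η) v')
  | TEq M N => DSet (fun v => v = VRefl /\ isub (lsub θ) M = isub (lsub θ) N)
  | TApp T M => dapp (interp T β θ η) (isub (lsub θ) M)
  | TLam T => DFun (fun M => interp T β (M :: θ) η)
  | TFVar X => lookup η X
  | TBVar i => nth i β (DSet (fun _ => False))
  | TMu K T => kmu K θ (fun X => dlift (tagS VInMu) (interp T (X :: β) θ η))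
  | TNu K T => knu K θ (fun X => dlift outS (interp T (X :: β) θ η))
  | TRec _ T0 Ts => dnum (nat_rect (fun _ => dom)
      (dlift (tagS (VInL l_zero)) (interp T0 β θ η))
      (fun n R =>
         dlift (tagS (VInL l_suc)) (interp Ts (R :: β) (num n :: θ) η)))
  end.

Definition tyI (T : ty) (θ : isubst L) (η : tvenv) (v : val) : Prop :=
  delem (interp T [] θ η) v.

Definition tvctxI (Ξ : tvctx) (θ : isubst L) (η : tvenv) : Prop :=
  Forall2 (fun p q => fst p = fst q /\ kindI (snd p) θ (snd q)) Ξ η.

Definition ctxI (Γ : ctx) (θ : isubst L) (η : tvenv) (σ : env) : Prop :=
  Forall2 (fun T v => tyI T θ η v) Γ σ.

End Tores.

Arguments kind : clear implicits.
Arguments ty : clear implicits.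
Arguments tvctx : clear implicits.
Arguments ctx : clear implicits.
Arguments tm : clear implicits.
Arguments fn : clear implicits.
Arguments val : clear implicits.
Arguments closure : clear implicits.
Arguments env : clear implicits.
Arguments dom : clear implicits.
Arguments tvenv : clear implicits.

(* Main.v *)
(** Induction on the typing derivation.  Interpretations of types are invariant
    under conversion and commute with substitution as Leibniz equalities, which
    needs extensionality.  For [rec f.t], let [C(Ms)] be the set of values that the
    closure maps into [T]; whenever [X ≤ C], instantiating the fresh type variable
    with [X] puts the closure into the type assumed for [f], so the induction
    hypothesis for [t] gives [in_μ* [[S]](X) ≤ C].  Thus [C] is one of the sets whose
    meet is the fixed point, and no monotonicity is needed.  For [corec f.t], dually,
    [C(Ms)] is the set of closures suspended at [Ms].  Folding and unfolding a fixed
    point only compare values at well-typed arguments, so the arguments of the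
    fixed point have to be recovered from its kinding. *)

Require Import Defs.
From Stdlib Require Import List.
From Stdlib Require Import Arith Lia ClassicalEpsilon FunctionalExtensionality PropExtensionality.
Import ListNotations.

Section Termination.
Context {L : index_sig} (HL : index_laws L).

Implicit Types (s : nat -> itm L) (M N : itm L) (Ms : list (itm L)) (θ Θ : isubst L)
  (U : ity L) (Us : list (ity L)) (Δ : ictx L) (K : kind L) (T : ty L)
  (Ξ : tvctx L) (Γ : ctx L) (η : tvenv L) (σ : env L) (C D : dom L)
  (β : list (dom L)).

(** * Index substitutions *)

Definition comp s2 s1 : nat -> itm L := fun i => isub s2 (s1 i).

Lemma scat_nil s : scat [] s = s.
Proof.
  extensionality i. unfold scat. destruct i; simpl; reflexivity.
Qed.

Lemma scat_cons_S M Θ s i : scat (M :: Θ) s (S i) = scat Θ s i.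
Proof. reflexivity. Qed.

Lemma scat_cons M Θ s : scat (M :: Θ) s = scat [M] (scat Θ s).
Proof.
  extensionality i. destruct i as [|i]; [reflexivity|].
  rewrite !scat_cons_S, scat_nil. reflexivity.
Qed.

Lemma scat_app Θ1 Θ2 s : scat (Θ1 ++ Θ2) s = scat Θ1 (scat Θ2 s).
Proof.
  induction Θ1 as [|M Θ1 IH]; simpl.
  - now rewrite scat_nil.
  - now rewrite scat_cons, IH, <- scat_cons.
Qed.

Lemma lsub_cons M θ : lsub (M :: θ) = scat [M] (lsub θ).
Proof. apply scat_cons. Qed.

Lemma lsub_app Θ θ : lsub (Θ ++ θ) = scat Θ (lsub θ).
Proof. apply scat_app. Qed.

Lemma comp_scat s2 Θ s1 : comp s2 (scat Θ s1) = scat (map (isub s2) Θ) (comp s2 s1).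
Proof.
  extensionality i. revert i.
  induction Θ as [|M Θ IH]; intros i; simpl.
  - now rewrite !scat_nil.
  - destruct i as [|i]; [reflexivity|].
    unfold comp at 1. rewrite !scat_cons_S. apply IH.
Qed.

Lemma comp_ivar s : comp s ivar = s.
Proof. extensionality i. apply (isub_ivar HL). Qed.

Lemma isub_comp s2 s1 M : isub s2 (isub s1 M) = isub (comp s2 s1) M.
Proof. apply (isub_isub HL). Qed.

Lemma iusub_comp s2 s1 U : iusub s2 (iusub s1 U) = iusub (comp s2 s1) U.
Proof. apply (iusub_iusub HL). Qed.

Lemma comp_ishift k Θ s : length Θ = k -> comp (scat Θ s) (ishift k) = s.
Proof.
  intros <-. extensionality i. unfold comp, ishift. rewrite (isub_ivar HL).
  unfold scat. rewrite (proj2 (nth_error_None Θ (length Θ + i))) by lia.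
  f_equal. lia.
Qed.

(** The shift inside [up s1] skips exactly the entry [M]. The interpretation crosses a binder by
    adding a value to the environment, which is this situation. *)
Lemma comp_up M s2 s1 : comp (scat [M] s2) (up s1) = scat [M] (comp s2 s1).
Proof.
  extensionality i. destruct i as [|i]; unfold comp at 1; simpl up.
  - now rewrite (isub_ivar HL).
  - rewrite isub_comp, comp_ishift by reflexivity.
    rewrite scat_cons_S, scat_nil. reflexivity.
Qed.

Lemma comp_upn k Ms s2 s1 : length Ms = k ->
  comp (scat (rev Ms) s2) (upn k s1) = scat (rev Ms) (comp s2 s1).
Proof.
  revert k s1 s2. induction Ms as [|M Ms IH]; intros k s1 s2 <-.
  - simpl. now rewrite !scat_nil.
  - simpl rev. rewrite !scat_app.
    (* The outermost variable comes first in [Ms] and belongs to the innermost [up], so the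
       iteration is unrolled at its inner end. *)
    unfold upn. simpl length. rewrite Nat.iter_succ_r.
    fold (upn (length Ms) (up s1)). rewrite IH by reflexivity.
    now rewrite comp_up.
Qed.

Lemma comp_inst s Ms : comp s (inst Ms) = scat (rev (map (isub s) Ms)) s.
Proof. unfold inst. now rewrite comp_scat, map_rev, comp_ivar. Qed.

Lemma comp_lsub θ Θ : comp (lsub θ) (lsub Θ) = lsub (icomp Θ θ).
Proof.
  unfold lsub at 2. rewrite comp_scat. unfold lsub at 3, icomp. f_equal.
  (* Beyond the end of [Θ] only the default [izero] is left, and every substitution fixes it. *)
  extensionality i. apply (isub_izero HL).
Qed.

Lemma comp_inst_lsub θ Ms :
  comp (lsub θ) (inst Ms) = lsub (rev (map (isub (lsub θ)) Ms) ++ θ).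
Proof. now rewrite comp_inst, lsub_app. Qed.

Lemma comp_ishift_lsub k Ms θ : length Ms = k ->
  comp (lsub (rev Ms ++ θ)) (ishift k) = lsub θ.
Proof.
  intros H. rewrite lsub_app. apply comp_ishift. now rewrite length_rev.
Qed.

Lemma comp_ishift1_lsub M θ : comp (lsub (M :: θ)) (ishift 1) = lsub θ.
Proof. exact (comp_ishift_lsub 1 [M] θ eq_refl). Qed.

Lemma comp_isuc_lsub N θ :
  comp (lsub (N :: θ)) (scat [isuc (ivar 0)] (ishift 1)) = lsub (isuc N :: θ).
Proof.
  rewrite comp_scat, comp_ishift1_lsub, lsub_cons. simpl.
  rewrite (isub_isuc HL), (isub_ivar HL), lsub_cons. reflexivity.
Qed.

Lemma map_isub_ivars Ms θ k : length Ms = k ->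
  map (isub (lsub (rev Ms ++ θ))) (ivars k) = Ms.
Proof.
  intros <-. unfold ivars. rewrite map_map, map_rev.
  (* With the reversal undone, it remains to read a list back off its own [scat] at positions 0, 1,
     and so on; the substitution behind it is arbitrary. *)
  transitivity (rev (rev Ms)); [f_equal|apply rev_involutive].
  rewrite <- length_rev. generalize (rev Ms). clear Ms. intros Ms.
  rewrite (map_ext _ (fun i => lsub (Ms ++ θ) i)) by (intros; apply (isub_ivar HL)).
  rewrite lsub_app. generalize (lsub θ). clear θ.
  induction Ms as [|M Ms IH]; intros s; simpl; f_equal.
  rewrite <- seq_shift, map_map.
  rewrite (map_ext _ (fun i => scat Ms s i)) by reflexivity. apply IH.
Qed.

Lemma up_ivar : up (@ivar L) = ivar.
Proof.
  extensionality i. destruct i as [|i]; [reflexivity|]. simpl. now rewrite (isub_ivar HL).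
Qed.

Lemma ksub_ivar K : ksub ivar K = K.
Proof.
  induction K as [|U K IH]; simpl; [reflexivity|].
  now rewrite up_ivar, IH, (iusub_id HL).
Qed.

Lemma ksub_comp K s1 s2 : ksub s2 (ksub s1 K) = ksub (comp s2 s1) K.
Proof.
  revert s1 s2. induction K as [|U K IH]; intros s1 s2; simpl; [reflexivity|].
  rewrite iusub_comp, IH. f_equal. f_equal. extensionality i.
  unfold comp. destruct i as [|i]; simpl.
  - now rewrite (isub_ivar HL).
  - rewrite !isub_comp. f_equal. extensionality j. unfold comp, ishift at 1.
    now rewrite (isub_ivar HL).
Qed.

(** * Interpretation of substituted types *)

(** The hypothesis shared by the substitution lemmas: [θ'] acts like [s] followed by [θ]. It covers
    instantiation, shifting and simultaneous substitution at once and, by [sub_env_up], survives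
    index binders. *)
Lemma itypeI_sub s θ θ' U M : lsub θ' = comp (lsub θ) s ->
  itypeI (iusub s U) θ M = itypeI U θ' M.
Proof. intros H. unfold itypeI. now rewrite iusub_comp, H. Qed.

Lemma sub_env_up s θ θ' M : lsub θ' = comp (lsub θ) s ->
  lsub (M :: θ') = comp (lsub (M :: θ)) (up s).
Proof. intros H. now rewrite !lsub_cons, comp_up, H. Qed.

Lemma sub_env_upn s θ θ' k Ms : lsub θ' = comp (lsub θ) s -> length Ms = k ->
  lsub (rev Ms ++ θ') = comp (lsub (rev Ms ++ θ)) (upn k s).
Proof. intros H Hk. now rewrite !lsub_app, comp_upn, H. Qed.

Lemma teleI_length Us θ Ms : teleI Us θ Ms -> length Ms = length Us.
Proof.
  revert θ Ms. induction Us as [|U Us IH]; intros θ [|M Ms]; simpl; try easy.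
  intros [_ H]. f_equal. eauto.
Qed.

Lemma teleI_sub Us s θ θ' Ms : lsub θ' = comp (lsub θ) s ->
  teleI (telsub s Us) θ Ms = teleI Us θ' Ms.
Proof.
  revert s θ θ' Ms. induction Us as [|U Us IH]; intros s θ θ' [|M Ms] H; simpl; auto.
  f_equal; [now apply itypeI_sub|]. apply IH. now apply sub_env_up.
Qed.

Lemma kindI_sub K s θ θ' C : lsub θ' = comp (lsub θ) s ->
  kindI (ksub s K) θ C = kindI K θ' C.
Proof.
  revert s θ θ' C. induction K as [|U K IH]; intros s θ θ' C H; simpl; [reflexivity|].
  f_equal. extensionality f. f_equal. apply propositional_extensionality.
  split; intros A M HM.
  - rewrite <- (IH (up s) (M :: θ)) by now apply sub_env_up.
    apply A. now rewrite (itypeI_sub s θ θ').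
  - rewrite (IH _ _ (M :: θ')) by now apply sub_env_up.
    apply A. now rewrite <- (itypeI_sub s θ θ').
Qed.

Lemma kle_sub K s θ θ' C D : lsub θ' = comp (lsub θ) s ->
  kle (ksub s K) θ C D = kle K θ' C D.
Proof.
  revert s θ θ' C D.
  induction K as [|U K IH]; intros s θ θ' C D H; simpl; [reflexivity|].
  apply propositional_extensionality. split; intros A M HM.
  - rewrite <- (IH (up s) (M :: θ)) by now apply sub_env_up.
    apply A. now rewrite (itypeI_sub s θ θ').
  - rewrite (IH _ _ (M :: θ')) by now apply sub_env_up.
    apply A. now rewrite <- (itypeI_sub s θ θ').
Qed.

(** Only the nesting of Π in [K] matters to [kmeet], and substitution leaves it alone. *)
Lemma kmeet_sub K s F : kmeet (ksub s K) F = kmeet K F.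
Proof.
  revert s F. induction K as [|U K IH]; intros s F; simpl; [reflexivity|].
  f_equal. extensionality M. apply IH.
Qed.

Lemma kjoin_sub K s F : kjoin (ksub s K) F = kjoin K F.
Proof.
  revert s F. induction K as [|U K IH]; intros s F; simpl; [reflexivity|].
  f_equal. extensionality M. apply IH.
Qed.

Lemma kmu_sub K s θ θ' F : lsub θ' = comp (lsub θ) s ->
  kmu (ksub s K) θ F = kmu K θ' F.
Proof.
  intros H. unfold kmu. rewrite kmeet_sub. f_equal. extensionality C.
  rewrite (kindI_sub K s θ θ' C H). f_equal.
  apply propositional_extensionality. split; intros A X HX HXC.
  - rewrite <- (kle_sub K s θ) by assumption. apply A.
    + now rewrite (kindI_sub K s θ θ').
    + now rewrite (kle_sub K s θ θ').
  - rewrite (kle_sub K s θ θ') by assumption. apply A.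
    + now rewrite <- (kindI_sub K s θ θ').
    + now rewrite <- (kle_sub K s θ θ').
Qed.

Lemma knu_sub K s θ θ' F : lsub θ' = comp (lsub θ) s ->
  knu (ksub s K) θ F = knu K θ' F.
Proof.
  intros H. unfold knu. rewrite kjoin_sub. f_equal. extensionality C.
  rewrite (kindI_sub K s θ θ' C H). f_equal.
  apply propositional_extensionality. split; intros A X HX HXC.
  - rewrite <- (kle_sub K s θ) by assumption. apply A.
    + now rewrite (kindI_sub K s θ θ').
    + now rewrite (kle_sub K s θ θ').
  - rewrite (kle_sub K s θ θ') by assumption. apply A.
    + now rewrite <- (kindI_sub K s θ θ').
    + now rewrite <- (kle_sub K s θ θ').
Qed.

(** The function space of [interp] with its two families as parameters, so that arrow types can be
    compared through [arrS_ext]. *)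
Definition arrS Us θ (A B : list (itm L) -> dom L) : dom L :=
  DSet (fun v => exists c, v = VClos c /\
    forall Ms a, teleI Us θ Ms -> delem (A Ms) a ->
    exists w, delem (B Ms) w /\ eval_app c Ms a w).

(** Agreement is asked only on well-typed spines: their known length is what makes the environments
    under the telescope comparable. *)
Lemma arrS_ext Us Us' θ θ' A A' B B' :
  (forall Ms, teleI Us θ Ms = teleI Us' θ' Ms) ->
  (forall Ms, teleI Us' θ' Ms -> A Ms = A' Ms) ->
  (forall Ms, teleI Us' θ' Ms -> B Ms = B' Ms) ->
  arrS Us θ A B = arrS Us' θ' A' B'.
Proof.
  intros HU HA HB. unfold arrS. f_equal. extensionality v. f_equal.
  extensionality c. f_equal. apply propositional_extensionality.
  split; intros H Ms a HMs Ha.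
  - rewrite <- HB by assumption. apply H; [now rewrite HU|now rewrite HA].
  - rewrite HU in HMs. rewrite HB by assumption.
    apply H; [assumption|now rewrite <- HA].
Qed.

Lemma interp_arr Us T1 T2 β θ η :
  interp (TArr Us T1 T2) β θ η =
  arrS Us θ (fun Ms => interp T1 β (rev Ms ++ θ) η) (fun Ms => interp T2 β (rev Ms ++ θ) η).
Proof. reflexivity. Qed.

Lemma interp_tysub T s β θ θ' η : lsub θ' = comp (lsub θ) s ->
  interp (tysub s T) β θ η = interp T β θ' η.
Proof.
  revert s β θ θ'.
  induction T as [|T1 IH1 T2 IH2|T1 IH1 T2 IH2|Us T1 IH1 T2 IH2|U T IH|M N|T IH M
    |T IH|X|i|K T IH|K T IH|K T0 IH0 Ts IHs];
    intros s β θ θ' H.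
  - reflexivity.
  - simpl. now rewrite (IH1 s β θ θ'), (IH2 s β θ θ').
  - simpl. now rewrite (IH1 s β θ θ'), (IH2 s β θ θ').
  - simpl tysub. rewrite !interp_arr. apply arrS_ext.
    + intros. now apply teleI_sub.
    + intros Ms HMs. apply IH1, sub_env_upn; [assumption|].
      now apply teleI_length with θ'.
    + intros Ms HMs. apply IH2, sub_env_upn; [assumption|].
      now apply teleI_length with θ'.
  - simpl. f_equal. extensionality v. f_equal. extensionality M. f_equal.
    extensionality v'. f_equal. f_equal; [now apply itypeI_sub|].
    rewrite (IH (up s) β (M :: θ) (M :: θ')); [reflexivity|now apply sub_env_up].
  - simpl. now rewrite !isub_comp, H.
  - simpl. now rewrite isub_comp, H, (IH s β θ θ').
  - simpl. f_equal. extensionality M. now apply IH, sub_env_up.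
  - reflexivity.
  - reflexivity.
  - simpl. rewrite (kmu_sub K s θ θ') by assumption. f_equal. extensionality X.
    now rewrite (IH s _ θ θ').
  - simpl. rewrite (knu_sub K s θ θ') by assumption. f_equal. extensionality X.
    now rewrite (IH s _ θ θ').
  - simpl. f_equal. rewrite (IH0 s β θ θ') by assumption. f_equal.
    extensionality n. extensionality R.
    now rewrite (IHs (up s) _ (num n :: θ) (num n :: θ')) by now apply sub_env_up.
Qed.

Lemma interp_inst T Ms β θ η :
  interp (tysub (inst Ms) T) β θ η
  = interp T β (rev (map (isub (lsub θ)) Ms) ++ θ) η.
Proof. apply interp_tysub. now rewrite comp_inst_lsub. Qed.

Lemma interp_ishift T Ms k β θ η : length Ms = k ->
  interp (tysub (ishift k) T) β (rev Ms ++ θ) η = interp T β θ η.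
Proof. intros H. apply interp_tysub. now rewrite comp_ishift_lsub. Qed.

Lemma interp_ishift1 T M β θ η :
  interp (tysub (ishift 1) T) β (M :: θ) η = interp T β θ η.
Proof. exact (interp_ishift T [M] 1 β θ η eq_refl). Qed.

(** [TLam] denotes a metalevel function of the index term, so β is the substitution lemma; the other
    rules hold because equality is a congruence. *)
Lemma interp_teq T T' : teq T T' ->
  forall β θ η, interp T β θ η = interp T' β θ η.
Proof.
  induction 1; intros β θ η; simpl; auto.
  - now rewrite interp_inst.
  - now rewrite IHteq1.
  - now rewrite IHteq1, IHteq2.
  - now rewrite IHteq1, IHteq2.
  - apply arrS_ext; intros; auto.
  - f_equal. extensionality v. f_equal. extensionality M. f_equal.
    extensionality v'. now rewrite IHteq.
  - now rewrite IHteq.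
  - f_equal. extensionality M. apply IHteq.
  - f_equal. extensionality X. now rewrite IHteq.
  - f_equal. extensionality X. now rewrite IHteq.
  - rewrite IHteq1. do 2 f_equal. extensionality n. extensionality R.
    now rewrite IHteq2.
Qed.

Lemma interp_ftv T β θ η η' :
  (forall X, In X (ftv T) -> lookup η X = lookup η' X) ->
  interp T β θ η = interp T β θ η'.
Proof.
  revert β θ.
  induction T as [|T1 IH1 T2 IH2|T1 IH1 T2 IH2|Us T1 IH1 T2 IH2|U T IH|M N|T IH M
    |T IH|X|i|K T IH|K T IH|K T0 IH0 Ts IHs];
    intros β θ H; simpl in H.
  - reflexivity.
  - simpl. rewrite IH1, IH2; auto using in_or_app.
  - simpl. rewrite IH1, IH2; auto using in_or_app.
  - rewrite !interp_arr. apply arrS_ext; auto using in_or_app.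
  - simpl. f_equal. extensionality v. f_equal. extensionality M. f_equal.
    extensionality v'. now rewrite IH.
  - reflexivity.
  - simpl. now rewrite IH.
  - simpl. f_equal. extensionality M. auto.
  - simpl. auto.
  - reflexivity.
  - simpl. f_equal. extensionality X. now rewrite IH.
  - simpl. f_equal. extensionality X. now rewrite IH.
  - simpl. rewrite IH0 by auto using in_or_app. do 2 f_equal.
    extensionality n. extensionality R. rewrite IHs; auto using in_or_app.
Qed.

Lemma interp_fresh T β θ η X C : ~ In X (ftv T) ->
  interp T β θ ((X, C) :: η) = interp T β θ η.
Proof.
  intros H. apply interp_ftv. intros Y HY. simpl.
  destruct (Nat.eqb_spec Y X); [congruence|reflexivity].
Qed.

(** * Locally closed types *)

(** Local closure in the locally nameless style, for type variables only. At level 0 it makes the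
    interpretation independent of [β], by [interp_lc]. *)
Fixpoint lc (n : nat) (T : ty L) : Prop :=
  match T with
  | TUnit | TEq _ _ | TFVar _ => True
  | TProd T1 T2 | TSum T1 T2 | TArr _ T1 T2 => lc n T1 /\ lc n T2
  | TSig _ T | TApp T _ | TLam T => lc n T
  | TBVar i => i < n
  | TMu _ T | TNu _ T => lc (S n) T
  | TRec _ T0 Ts => lc n T0 /\ lc (S n) Ts
  end.

Lemma lc_tysub T n s : lc n (tysub s T) <-> lc n T.
Proof.
  revert n s. induction T; intros n s'; simpl;
    repeat match goal with H : forall n s, _ <-> _ |- _ => rewrite H; clear H end;
    reflexivity.
Qed.

Lemma lc_teq T T' : teq T T' -> forall n, lc n T <-> lc n T'.
Proof.
  induction 1; intros n; simpl; try reflexivity;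
    rewrite ?lc_tysub;
    repeat match goal with H : forall n, _ <-> _ |- _ => rewrite H; clear H end;
    reflexivity.
Qed.

Lemma lc_topen T n X : lc n (topen n (TFVar X) T) -> lc (S n) T.
Proof.
  revert n. induction T; intros n; simpl; auto;
    try (intros [? ?]; split; auto; fail).
  destruct (Nat.eqb_spec i n); simpl; lia.
Qed.

Lemma lc_tapps T Ms n : lc n (tapps T Ms) <-> lc n T.
Proof. revert T. induction Ms as [|M Ms IH]; intros T; [reflexivity|exact (IH (TApp T M))]. Qed.

Scheme kcheck_mut := Minimality for kcheck Sort Prop
  with ksynth_mut := Minimality for ksynth Sort Prop.

(** Kinding opens every type binder with a name; [lc_topen] undoes the opening, and [lc_teq] takes
    care of conversion. *)
Lemma kcheck_lc Δ Ξ T K : kcheck Δ Ξ T K -> lc 0 T.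
Proof.
  intros H. induction H using kcheck_mut
    with (P0 := fun _ _ T _ => lc 0 T); simpl; eauto using lc_topen.
  - now rewrite lc_teq by eassumption.
  - now rewrite lc_teq by eassumption.
Qed.

Lemma interp_lc T n β β' θ η :
  lc n T ->
  (forall i, i < n -> nth i β (DSet (fun _ => False)) = nth i β' (DSet (fun _ => False))) ->
  interp T β θ η = interp T β' θ η.
Proof.
  revert n β β' θ.
  induction T as [|T1 IH1 T2 IH2|T1 IH1 T2 IH2|Us T1 IH1 T2 IH2|U T IH|M N|T IH M
    |T IH|X|i|K T IH|K T IH|K T0 IH0 Ts IHs];
    intros n β β' θ Hl H; simpl in Hl.
  - reflexivity.
  - simpl. rewrite (IH1 n β β'), (IH2 n β β'); tauto.
  - simpl. rewrite (IH1 n β β'), (IH2 n β β'); tauto.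
  - rewrite !interp_arr. apply arrS_ext; auto; intros; [apply (IH1 n)|apply (IH2 n)]; tauto.
  - simpl. f_equal. extensionality v. f_equal. extensionality M. f_equal.
    extensionality v'. now rewrite (IH n β β').
  - reflexivity.
  - simpl. now rewrite (IH n β β').
  - simpl. f_equal. extensionality M. eauto.
  - reflexivity.
  - simpl. auto.
  - simpl. f_equal. extensionality X. rewrite (IH (S n) (X :: β) (X :: β')); auto.
    intros [|i] Hi; simpl; auto with arith.
  - simpl. f_equal. extensionality X. rewrite (IH (S n) (X :: β) (X :: β')); auto.
    intros [|i] Hi; simpl; auto with arith.
  - simpl. rewrite (IH0 n β β') by tauto. do 2 f_equal.
    extensionality k. extensionality R. rewrite (IHs (S n) (R :: β) (R :: β')); try tauto.
    intros [|i] Hi; simpl; auto with arith.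
Qed.

(** The hypothesis on [R] is local closure in semantic form; it is stable under
    the shifts that [topen] applies to [R]. *)
Lemma interp_topen T n R C β β' θ η :
  (forall β0, interp R β0 θ η = C) ->
  (forall i, nth i β' (DSet (fun _ => False))
     = if Nat.eqb i n then C else nth i β (DSet (fun _ => False))) ->
  interp (topen n R T) β θ η = interp T β' θ η.
Proof.
  revert n R β β' θ.
  induction T as [|T1 IH1 T2 IH2|T1 IH1 T2 IH2|Us T1 IH1 T2 IH2|U T IH|M N|T IH M
    |T IH|X|i|K T IH|K T IH|K T0 IH0 Ts IHs];
    intros n R β β' θ HR H.
  - reflexivity.
  - simpl. now rewrite (IH1 n R β β'), (IH2 n R β β').
  - simpl. now rewrite (IH1 n R β β'), (IH2 n R β β').
  - simpl topen. rewrite !interp_arr.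
    apply arrS_ext; auto; intros Ms HMs; [apply IH1|apply IH2]; auto;
      intros β0; rewrite interp_ishift; auto; now apply teleI_length with θ.
  - simpl. f_equal. extensionality v. f_equal. extensionality M. f_equal.
    extensionality v'. rewrite (IH n _ β β'); auto.
    intros β0. now rewrite interp_ishift1.
  - reflexivity.
  - simpl. now rewrite (IH n R β β').
  - simpl. f_equal. extensionality M. apply IH; auto.
    intros β0. now rewrite interp_ishift1.
  - reflexivity.
  - simpl. rewrite H. destruct (Nat.eqb i n); simpl; auto.
  - simpl. f_equal. extensionality X. rewrite (IH (S n) R (X :: β) (X :: β')); auto.
    intros [|i]; simpl; auto.
  - simpl. f_equal. extensionality X. rewrite (IH (S n) R (X :: β) (X :: β')); auto.
    intros [|i]; simpl; auto.
  - simpl. rewrite (IH0 n R β β') by assumption. do 2 f_equal.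
    extensionality k. extensionality Y.
    rewrite (IHs (S n) _ (Y :: β) (Y :: β')); auto.
    + intros β0. now rewrite interp_ishift1.
    + intros [|i]; simpl; auto.
Qed.

(** The typing rules give a bound type variable a fresh name, valued in [η], while the
    interpretation of its binder puts the value in [β]; this passes between the two. *)
Lemma interp_topen_fvar T X θ η C : ~ In X (ftv T) ->
  interp (topen 0 (TFVar X) T) [] θ ((X, C) :: η) = interp T [C] θ η.
Proof.
  intros HX. rewrite (interp_topen T 0 (TFVar X) C [] [C]).
  - now apply interp_fresh.
  - intros β0. simpl. now rewrite Nat.eqb_refl.
  - intros [|[|i]]; reflexivity.
Qed.

(** Substituting the fixed point amounts to feeding its value to the body, as the operator under μ
    or ν does. Closure of [R] makes that value the same under every [β]. *)
Lemma interp_tunfold T Ms R θ η : lc 0 R ->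
  interp (tunfold T Ms R) [] θ η
  = interp T [interp R [] θ η] (rev (map (isub (lsub θ)) Ms) ++ θ) η.
Proof.
  intros HR. unfold tunfold. rewrite interp_inst.
  apply interp_topen with (C := interp R [] θ η).
  - intros β0. rewrite interp_ishift by apply length_map.
    apply interp_lc with 0; [assumption|lia].
  - intros [|[|i]]; reflexivity.
Qed.

(** * Lifted operations and fixed points *)

Definition dapps C Ms : dom L := fold_left (@dapp L) Ms C.

Lemma interp_tapps T Ms β θ η :
  interp (tapps T Ms) β θ η = dapps (interp T β θ η) (map (isub (lsub θ)) Ms).
Proof. revert T. induction Ms as [|M Ms IH]; intros T; [reflexivity|exact (IH (TApp T M))]. Qed.

Lemma dapps_tlams T Ms k β θ η : length Ms = k ->
  dapps (interp (tlams k T) β θ η) Ms = interp T β (rev Ms ++ θ) η.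
Proof.
  intros <-. revert θ. induction Ms as [|M Ms IH]; intros θ; simpl; [reflexivity|].
  rewrite <- app_assoc. simpl. rewrite <- IH. reflexivity.
Qed.

(** [dom] is not indexed by kinds, so [Ms] may be too long or too short for [C]. Both mismatches
    have no elements, and strictness of [F] keeps the equivalence true there. *)
Lemma delem_dapps_dlift (F : (val L -> Prop) -> val L -> Prop) C Ms v :
  (forall w, ~ F (fun _ => False) w) ->
  delem (dapps (dlift F C) Ms) v <-> F (delem (dapps C Ms)) v.
Proof.
  intros HF. revert C. induction Ms as [|M Ms IH]; intros C.
  - destruct C as [P|f]; simpl; [reflexivity|].
    split; [easy|]. apply HF.
  - simpl. destruct C as [P|f]; simpl; [|apply IH].
    rewrite <- IH. simpl.
    replace (F (fun _ => False)) with (fun _ : val L => False); [reflexivity|].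
    extensionality w. apply propositional_extensionality. split; [easy|apply HF].
Qed.

Lemma tagS_strict (tag : val L -> val L) w : ~ tagS tag (fun _ => False) w.
Proof. now intros (v & [] & _). Qed.

Lemma outS_strict (w : val L) : ~ outS (fun _ => False) w.
Proof. now intros (c & _ & w' & [] & _). Qed.

(** * Completeness of the lattices of kinds, and fixed points in them *)

Lemma kindI_kmeet K θ F : kindI K θ (kmeet K F).
Proof.
  revert θ F. induction K as [|U K IH]; intros θ F; simpl; [eauto|].
  eexists. split; [reflexivity|]. intros M _. apply IH.
Qed.

Lemma kindI_kjoin K θ F : kindI K θ (kjoin K F).
Proof.
  revert θ F. induction K as [|U K IH]; intros θ F; simpl; [eauto|].
  eexists. split; [reflexivity|]. intros M _. apply IH.
Qed.

Lemma kmeet_lb K θ (F : dom L -> Prop) C : F C -> kle K θ (kmeet K F) C.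
Proof. revert θ F C. induction K; simpl; eauto. Qed.

Lemma kmeet_glb K θ (F : dom L -> Prop) D :
  (forall C, F C -> kle K θ D C) -> kle K θ D (kmeet K F).
Proof.
  revert θ F D. induction K as [|U K IH]; simpl; intros θ F D H.
  - intros v Hv C HC. now apply (H C).
  - intros M HM. apply IH. intros C' (C & HC & ->). auto.
Qed.

Lemma kjoin_ub K θ (F : dom L -> Prop) C : F C -> kle K θ C (kjoin K F).
Proof. revert θ F C. induction K; simpl; eauto. Qed.

Lemma kjoin_lub K θ (F : dom L -> Prop) D :
  (forall C, F C -> kle K θ C D) -> kle K θ (kjoin K F) D.
Proof.
  revert θ F D. induction K as [|U K IH]; simpl; intros θ F D H.
  - intros v (C & HC & Hv). now apply (H C).
  - intros M HM. apply IH. intros C' (C & HC & ->). auto.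
Qed.

(** The meet lies below each candidate [C], so the condition on [C], taken at the meet itself, puts
    its image under [F] below [C]. The quantifier over all [X] below [C] takes the place of
    monotonicity. *)
Lemma kmu_fold K θ F : kle K θ (F (kmu K θ F)) (kmu K θ F).
Proof.
  apply kmeet_glb. intros C HC. apply HC.
  - apply kindI_kmeet.
  - now apply kmeet_lb.
Qed.

(** Dually, each candidate lies below the join, and its condition is taken at the join. *)
Lemma knu_unfold K θ F : kle K θ (knu K θ F) (F (knu K θ F)).
Proof.
  apply kjoin_lub. intros C HC. apply HC.
  - apply kindI_kjoin.
  - now apply kjoin_ub.
Qed.

(** Makes a predicate on spines an element of the lattice of [kpis Us KStar]; the candidates for
    [rec] and [corec] are built this way. *)
Fixpoint dcurry (k : nat) (P : list (itm L) -> val L -> Prop) : dom L :=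
  match k with
  | 0 => DSet (P [])
  | S k => DFun (fun M => dcurry k (fun Ms => P (M :: Ms)))
  end.

Lemma kindI_dcurry Us θ P : kindI (kpis Us KStar) θ (dcurry (length Us) P).
Proof.
  revert θ P. induction Us as [|U Us IH]; intros θ P; simpl; [eauto|].
  eexists. split; [reflexivity|]. intros M _. apply IH.
Qed.

Lemma delem_dcurry Ms k P v : length Ms = k ->
  delem (dapps (dcurry k P) Ms) v <-> P Ms v.
Proof.
  intros <-. revert P. induction Ms as [|M Ms IH]; intros P; simpl; [reflexivity|].
  apply IH.
Qed.

Lemma kle_kpis Us θ C D :
  kle (kpis Us KStar) θ C D <->
  forall Ms v, teleI Us θ Ms -> delem (dapps C Ms) v -> delem (dapps D Ms) v.
Proof.
  revert θ C D. induction Us as [|U Us IH]; intros θ C D; simpl.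
  - split; [intros H [|] v []; apply H|intros H v; now apply (H [])].
  - split.
    + intros H [|M Ms] v []. apply (proj1 (IH _ _ _)) with (2 := H1). auto.
    + intros H M HM. apply IH. intros Ms v HMs. apply (H (M :: Ms)). auto.
Qed.

(** * Numerals and the recursive type over them *)

Lemma num_inj n m : num n = num m :> itm L -> n = m.
Proof.
  revert m. induction n as [|n IH]; intros [|m] H; simpl in H; auto.
  - now apply (izero_isuc HL) in H.
  - symmetry in H. now apply (izero_isuc HL) in H.
  - f_equal. apply IH. now apply (isuc_inj HL).
Qed.

(** [dnum] chooses some index whose numeral is [num n]; injectivity forces it to be [n]. *)
Lemma dapp_dnum (R : nat -> dom L) n : dapp (dnum R) (num n) = R n.
Proof.
  simpl. f_equal. symmetry. apply num_inj.
  apply epsilon_spec. now exists n.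
Qed.

Lemma interp_rec_zero K T0 Ts θ η :
  interp (TApp (TRec K T0 Ts) izero) [] θ η
  = dlift (tagS (VInL l_zero)) (interp T0 [] θ η).
Proof. cbn [interp]. rewrite (isub_izero HL). exact (dapp_dnum _ 0). Qed.

(** The value that [nat_rect] carries at [n] is the interpretation of the recursor applied to [N],
    which is the type substituted in the unfolding. *)
Lemma interp_rec_suc K T0 Ts N θ η n :
  lc 0 (TRec K T0 Ts) -> isub (lsub θ) N = num n ->
  interp (TApp (TRec K T0 Ts) (isuc N)) [] θ η
  = dlift (tagS (VInL l_suc))
      (interp (tunfold Ts [N] (TApp (TRec K T0 Ts) N)) [] θ η).
Proof.
  intros HR HN. rewrite interp_tunfold by exact HR.
  cbn [interp]. rewrite (isub_isuc HL). simpl map. rewrite HN.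
  rewrite dapp_dnum. exact (dapp_dnum _ (S n)).
Qed.

(** * Inversion of kinding *)

Inductive head : Type :=
| HVar
| HFix K
| HRec K.

(** Semantic weak head normal forms. [HFun] is a metalevel function, so β steps are computed;
    [HOther] lumps together the shapes that are never inverted. *)
Inductive hval : Type :=
| HEq M N
| HNeu (h : head) Ms
| HFun (f : itm L -> hval)
| HOther.

Definition hv_app (d : hval) M : hval :=
  match d with
  | HNeu h Ms => HNeu h (Ms ++ [M])
  | HFun f => f M
  | _ => HOther
  end.

(** Because of the conversion rules, a kinding of [M = N] or of [(μX:K.T) Ms] cannot
    be inverted directly.  [tyhead T s] evaluates the applied lambdas at the head
    of [T[s]]; it is invariant under conversion, and types that synthesize a kind
    have a neutral head whose arguments are well-typed. *)
Fixpoint tyhead (T : ty L) s : hval :=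
  match T with
  | TEq M N => HEq (isub s M) (isub s N)
  | TApp T M => hv_app (tyhead T s) (isub s M)
  | TLam T => HFun (fun M => tyhead T (scat [M] s))
  | TFVar _ | TBVar _ => HNeu HVar []
  | TMu K _ | TNu K _ => HNeu (HFix (ksub s K)) []
  | TRec K _ _ => HNeu (HRec (ksub s K)) []
  | _ => HOther
  end.

Lemma tyhead_tysub T s1 s2 : tyhead (tysub s1 T) s2 = tyhead T (comp s2 s1).
Proof.
  revert s1 s2. induction T; intros s1 s2; simpl; rewrite ?isub_comp, ?ksub_comp; auto.
  - now rewrite IHT.
  - f_equal. extensionality M. now rewrite IHT, comp_up.
Qed.

Lemma tyhead_teq T T' : teq T T' -> forall s, tyhead T s = tyhead T' s.
Proof.
  induction 1; intros s; simpl; auto.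
  - now rewrite tyhead_tysub, comp_inst.
  - congruence.
  - now rewrite IHteq.
  - f_equal. extensionality M. apply IHteq.
Qed.

(** The kind left over after applying a head of kind [K0]; the spine grows at the right, like the
    application rule. *)
Inductive kspine Δ K0 : list (itm L) -> kind L -> Prop :=
| kspine_nil : kspine Δ K0 [] K0
| kspine_snoc Ms U K M :
    kspine Δ K0 Ms (KPi U K) -> ityping Δ M U ->
    kspine Δ K0 (Ms ++ [M]) (ksub (inst [M]) K).

Definition neutral_ok Δ (h : head) Ms K : Prop :=
  match h with
  | HVar => True
  | HFix K0 => kspine Δ K0 Ms K
  | HRec K0 => kspine Δ K0 Ms K /\ exists K', K0 = KPi inat K'
  end.

Definition star_ok Δ (d : hval) : Prop :=
  match d with
  | HEq M N => exists U, ityping Δ M U /\ ityping Δ N U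
  | HNeu h Ms => neutral_ok Δ h Ms KStar
  | _ => True
  end.

(** Conversion leaves [tyhead] unchanged, so the induction on kinding passes through it. A
    synthesized kind comes from a neutral head, to which the application rule adds one typed
    argument. *)
Lemma kcheck_tyhead Δ Ξ T K :
  kcheck Δ Ξ T K -> K = KStar -> star_ok Δ (tyhead T ivar).
Proof.
  intros H.
  induction H using kcheck_mut
    with (P0 := fun Δ _ T K =>
            exists h Ms, tyhead T ivar = HNeu h Ms /\ neutral_ok Δ h Ms K);
    intros; simpl; auto; rewrite ?(isub_id HL); eauto.
  - destruct IHkcheck as (h & Ms & -> & Hok). exact Hok.
  - rewrite (tyhead_teq _ _ H). auto.
  - exists HVar, []. simpl. auto.
  - destruct IHkcheck as (h & Ms & -> & Hok). exists h, (Ms ++ [M]).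
    split; [reflexivity|].
    destruct h; simpl in *; auto.
    + econstructor; eauto.
    + destruct Hok as [Hs HK]. split; [econstructor; eauto|exact HK].
  - do 2 eexists. split; [reflexivity|]. simpl. rewrite ksub_ivar. constructor.
  - do 2 eexists. split; [reflexivity|]. simpl. rewrite ksub_ivar. constructor.
  - do 2 eexists. split; [reflexivity|]. simpl.
    rewrite (iusub_id HL), up_ivar, ksub_ivar. split; [constructor|eauto].
  - destruct IHkcheck as (h & Ms & E & Hok). exists h, Ms.
    now rewrite (tyhead_teq _ _ H).
Qed.

Lemma tyhead_tapps T h Ms0 Ms :
  tyhead T ivar = HNeu h Ms0 -> tyhead (tapps T Ms) ivar = HNeu h (Ms0 ++ Ms).
Proof.
  revert T Ms0. induction Ms as [|M Ms IH]; intros T Ms0 H; simpl.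
  - now rewrite app_nil_r.
  - rewrite (IH (TApp T M) (Ms0 ++ [M])); [now rewrite <- app_assoc|].
    simpl. now rewrite H, (isub_id HL).
Qed.

Lemma kcheck_eq_inv Δ Ξ M N : kcheck Δ Ξ (TEq M N) KStar ->
  exists U, ityping Δ M U /\ ityping Δ N U.
Proof.
  intros H. apply kcheck_tyhead in H; [|reflexivity].
  simpl in H. now rewrite !(isub_id HL) in H.
Qed.

Lemma kcheck_mu_inv Δ Ξ K T Ms : kcheck Δ Ξ (tapps (TMu K T) Ms) KStar ->
  kspine Δ K Ms KStar.
Proof.
  intros H. apply kcheck_tyhead in H; [|reflexivity].
  rewrite (tyhead_tapps _ (HFix K) []) in H; [exact H|].
  simpl. now rewrite ksub_ivar.
Qed.

Lemma kcheck_nu_inv Δ Ξ K T Ms : kcheck Δ Ξ (tapps (TNu K T) Ms) KStar ->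
  kspine Δ K Ms KStar.
Proof.
  intros H. apply kcheck_tyhead in H; [|reflexivity].
  rewrite (tyhead_tapps _ (HFix K) []) in H; [exact H|].
  simpl. now rewrite ksub_ivar.
Qed.

(** Since the spine grows at the right, its first argument is reached by descending to length
    one. *)
Lemma kspine_head_inv Δ U K0 K M Ms :
  kspine Δ (KPi U K0) (M :: Ms) K -> ityping Δ M U.
Proof.
  intros H. remember (M :: Ms) as Ms0 eqn:E. revert Ms E.
  induction H as [|Ms1 U1 K1 M1 Hs IH HM]; intros Ms E; [discriminate|].
  destruct Ms1 as [|M2 Ms1]; simpl in E; injection E as -> E.
  - inversion Hs as [|Ms2 U2 K2 M2 _ _ E2]; subst; [assumption|].
    now apply app_eq_nil in E2.
  - eauto.
Qed.

Lemma kcheck_rec_inv Δ Ξ K T0 Ts N Ms :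
  kcheck Δ Ξ (tapps (TApp (TRec K T0 Ts) N) Ms) KStar -> ityping Δ N inat.
Proof.
  intros H. apply kcheck_tyhead in H; [|reflexivity].
  rewrite (tyhead_tapps _ (HRec K) [N]) in H.
  - destruct H as [H [K' ->]]. now apply kspine_head_inv in H.
  - simpl. now rewrite ksub_ivar, (isub_id HL).
Qed.

(** Closing a well-typed argument by [θ] puts it among those at which the order compares. *)
Lemma kspine_kle Δ K0 Ms K θ C D :
  kspine Δ K0 Ms K -> subty [] θ Δ -> kle K0 θ C D ->
  kle K θ (dapps C (map (isub (lsub θ)) Ms)) (dapps D (map (isub (lsub θ)) Ms)).
Proof.
  intros H Hθ HCD. induction H as [|Ms U K M Hs IH HM]; simpl; [assumption|].
  rewrite map_app. unfold dapps. rewrite !fold_left_app. simpl.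
  rewrite (kle_sub K (inst [M]) θ (isub (lsub θ) M :: θ)).
  - apply IH. exact (ityping_lsub HL _ _ HM Hθ).
  - symmetry. apply comp_inst_lsub.
Qed.

(** The closed instance of [isuc N] is a numeral other than [izero], and injectivity of [isuc]
    exposes the predecessor. *)
Lemma closed_pred Δ N θ : ityping Δ (isuc N) inat -> subty [] θ Δ ->
  exists n, isub (lsub θ) N = num n.
Proof.
  intros HN Hθ. pose proof (ityping_lsub HL _ _ HN Hθ) as H.
  rewrite (iusub_inat HL), (isub_isuc HL) in H.
  apply (ityping_inat_closed HL) in H. destruct H as [[|n] E]; simpl in E.
  - symmetry in E. now apply (izero_isuc HL) in E.
  - exists n. now apply (isuc_inj HL).
Qed.

(** * Environments *)

Lemma subty_teleI Us Δ θ Ms : subty [] θ Δ -> teleI Us θ Ms ->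
  subty [] (rev Ms ++ θ) (rev Us ++ Δ).
Proof.
  revert Δ θ Ms. induction Us as [|U Us IH]; intros Δ θ [|M Ms] Hθ H; try easy.
  destruct H as [HM H]. simpl. rewrite <- !app_assoc. simpl.
  apply IH; [now constructor|assumption].
Qed.

Lemma spine_teleI Δ Ms Us θ : spine Δ Ms Us -> subty [] θ Δ ->
  teleI Us θ (map (isub (lsub θ)) Ms).
Proof.
  intros H Hθ. induction H as [|M Ms U Us HM Hs IH]; simpl; [exact I|].
  split; [exact (ityping_lsub HL _ _ HM Hθ)|].
  rewrite (teleI_sub Us (inst [M]) θ (isub (lsub θ) M :: θ)) in IH; [exact IH|].
  symmetry. apply comp_inst_lsub.
Qed.

Lemma tvctxI_sub Ξ s θ θ' η : lsub θ' = comp (lsub θ) s ->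
  tvctxI Ξ θ' η -> tvctxI (tvsub s Ξ) θ η.
Proof.
  intros E H. induction H as [|p q Ξ η [Hn Hk] H IH]; constructor; [|exact IH].
  split; [exact Hn|]. simpl. now rewrite (kindI_sub _ s θ θ').
Qed.

Lemma ctxI_sub Γ s θ θ' η σ : lsub θ' = comp (lsub θ) s ->
  ctxI Γ θ' η σ -> ctxI (ctxsub s Γ) θ η σ.
Proof.
  intros E H. induction H as [|T v Γ σ Hv H IH]; constructor; [|exact IH].
  unfold tyI. now rewrite (interp_tysub T s [] θ θ').
Qed.

Lemma ctxI_fresh Γ θ η σ X C : ~ In X (flat_map ftv Γ) ->
  ctxI Γ θ η σ -> ctxI Γ θ ((X, C) :: η) σ.
Proof.
  intros HX H. induction H as [|T v Γ σ Hv H IH]; constructor; simpl in HX.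
  - unfold tyI. rewrite interp_fresh; [exact Hv|]. auto using in_or_app.
  - apply IH. auto using in_or_app.
Qed.

Lemma ctxI_nth_error Γ θ η σ x T : ctxI Γ θ η σ -> nth_error Γ x = Some T ->
  exists v, nth_error σ x = Some v /\ tyI T θ η v.
Proof.
  intros H. revert x. induction H as [|S v Γ σ Hv H IH]; intros [|x] E; try discriminate.
  - injection E as <-. now exists v.
  - exact (IH x E).
Qed.

(** * Soundness of the typing rules *)

Definition sound Δ Ξ Γ (t : tm L) T : Prop :=
  forall θ η σ, subty [] θ Δ -> tvctxI Ξ θ η -> ctxI Γ θ η σ ->
  exists v, eval t θ σ v /\ tyI T θ η v.

Lemma ftv_tysub T s : ftv (tysub s T) = ftv T.
Proof. revert s. induction T; intros s'; simpl; congruence. Qed.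

Lemma ftv_tapps T Ms : ftv (tapps T Ms) = ftv T.
Proof. revert T. induction Ms as [|M Ms IH]; intros T; [reflexivity|exact (IH (TApp T M))]. Qed.

Lemma ftv_tlams T k : ftv (tlams k T) = ftv T.
Proof. induction k; simpl; auto. Qed.

(** In the rules for [rec] and [corec] the fixed point is shifted under the telescope and applied to
    its variables; extending the environment by [Ms] undoes both. *)
Lemma tyI_fix_args R Ms Us θ η v : teleI Us θ Ms ->
  delem (interp (tapps (tysub (ishift (length Us)) R) (ivars (length Us))) []
           (rev Ms ++ θ) η) v
  <-> delem (dapps (interp R [] θ η) Ms) v.
Proof.
  intros HMs. apply teleI_length in HMs.
  rewrite interp_tapps, map_isub_ivars, interp_ishift by assumption. reflexivity.
Qed.

Lemma tyI_fvar_args X C Ms Us θ η v : teleI Us θ Ms ->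
  delem (interp (tapps (TFVar X) (ivars (length Us))) [] (rev Ms ++ θ) ((X, C) :: η)) v
  <-> delem (dapps C Ms) v.
Proof.
  intros HMs. apply teleI_length in HMs.
  rewrite interp_tapps, map_isub_ivars by assumption.
  simpl. rewrite Nat.eqb_refl. reflexivity.
Qed.

Lemma sound_rec Δ Ξ Γ t Us S T X :
  let k := length Us in
  let K := kpis Us KStar in
  let R := TMu K (tlams k S) in
  let A := TArr Us (tapps (tysub (ishift k) R) (ivars k)) T in
  fresh X Ξ Γ t A ->
  sound Δ ((X, K) :: Ξ) (TArr Us (tapps (TFVar X) (ivars k)) T :: Γ) t
    (TArr Us (topen 0 (TFVar X) S) T) ->
  sound Δ Ξ Γ (Fn (GRec t)) A.
Proof.
  intros k K R A (_ & HΓ & _ & HA) IH θ η σ Hθ Hη Hσ. subst k K R A.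
  assert (HS : ~ In X (ftv S) /\ ~ In X (ftv T)).
  { simpl in HA. rewrite ftv_tapps in HA. simpl in HA.
    rewrite ftv_tysub, ftv_tlams in HA. split; intros HX; apply HA, in_or_app; auto. }
  destruct HS as [HS HT].
  eexists. split; [constructor|].
  eexists. split; [reflexivity|]. intros Ms a HMs Ha.
  rewrite tyI_fix_args in Ha by assumption.
  set (c := CFn (GRec t) θ σ) in *.
  pose (C := dcurry (length Us) (fun Ms v => exists w,
         delem (interp T [] (rev Ms ++ θ) η) w /\ eval_app c Ms v w)).
  assert (HC : forall Ms v, teleI Us θ Ms ->
    (delem (dapps C Ms) v <-> exists w,
      delem (interp T [] (rev Ms ++ θ) η) w /\ eval_app c Ms v w)).
  { intros Ms' v HMs'. apply delem_dcurry. now apply teleI_length with θ. }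
  apply HC; [assumption|].
  (* It suffices that the fixed point lies below [C]; as a meet it does once [C] belongs to its
     family. *)
  refine (proj1 (kle_kpis Us θ _ _) _ Ms a HMs Ha).
  apply kmeet_lb. split; [apply kindI_dcurry|].
  intros D HD HDC. apply kle_kpis. intros Ns v HNs Hv.
  apply delem_dapps_dlift in Hv; [|apply tagS_strict].
  destruct Hv as (v' & Hv' & ->).
  rewrite dapps_tlams in Hv' by (now apply teleI_length with θ).
  destruct (IH θ ((X, D) :: η) (VClos c :: σ)) as (vc & Hev & c' & -> & Hc').
  - assumption.
  - constructor; [now split|assumption].
  - constructor; [|now apply ctxI_fresh].
    eexists. split; [reflexivity|]. intros Ms' a' HMs' Ha'.
    rewrite tyI_fvar_args in Ha' by assumption.
    (* Whatever is in [D], the value of [X], is also in [C], so the closure is a legitimate value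
       for [f]. *)
    rewrite interp_fresh by assumption. apply HC; [assumption|].
    exact (proj1 (kle_kpis Us θ _ _) HDC Ms' a' HMs' Ha').
  - apply HC; [assumption|].
    (* The body evaluates to [c'], and applying [c'] to [v'] is what [ea_rec] does on [VInMu v']. *)
    destruct (Hc' Ns v' HNs) as (w & Hw & Hap).
    + now rewrite interp_topen_fvar.
    + rewrite interp_fresh in Hw by assumption.
      exists w. split; [assumption|]. econstructor; eassumption.
Qed.

Lemma sound_corec Δ Ξ Γ t Us S T X :
  let k := length Us in
  let K := kpis Us KStar in
  let R := TNu K (tlams k T) in
  let A := TArr Us S (tapps (tysub (ishift k) R) (ivars k)) in
  fresh X Ξ Γ t A ->
  sound Δ ((X, K) :: Ξ) (TArr Us S (tapps (TFVar X) (ivars k)) :: Γ) t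
    (TArr Us S (topen 0 (TFVar X) T)) ->
  sound Δ Ξ Γ (Fn (GCorec t)) A.
Proof.
  intros k K R A (_ & HΓ & _ & HA) IH θ η σ Hθ Hη Hσ. subst k K R A.
  assert (HS : ~ In X (ftv S) /\ ~ In X (ftv T)).
  { simpl in HA. rewrite ftv_tapps in HA. simpl in HA.
    rewrite ftv_tysub, ftv_tlams in HA. split; intros HX; apply HA, in_or_app; auto. }
  destruct HS as [HS HT].
  eexists. split; [constructor|].
  eexists. split; [reflexivity|]. intros Ms a HMs Ha.
  eexists. split; [|constructor].
  rewrite tyI_fix_args by assumption.
  set (c := CFn (GCorec t) θ σ).
  pose (C := dcurry (length Us) (fun Ms v => exists a,
         v = VClos (CCorec t θ σ Ms a) /\ delem (interp S [] (rev Ms ++ θ) η) a)).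
  assert (HC : forall Ms v, teleI Us θ Ms ->
    (delem (dapps C Ms) v <-> exists a,
         v = VClos (CCorec t θ σ Ms a) /\ delem (interp S [] (rev Ms ++ θ) η) a)).
  { intros Ms' v HMs'. apply delem_dcurry. now apply teleI_length with θ. }
  (* Application only suspends the closure, and the suspension is in [C]; it remains that [C] lies
     below the fixed point, a join. *)
  refine (proj1 (kle_kpis Us θ C _) _ Ms _ HMs _); [|apply HC; eauto].
  apply kjoin_ub. split; [apply kindI_dcurry|].
  intros D HD HCD. apply kle_kpis. intros Ns v HNs Hv.
  apply HC in Hv; [|assumption]. destruct Hv as (a' & -> & Ha').
  apply delem_dapps_dlift; [apply outS_strict|].
  rewrite dapps_tlams by (now apply teleI_length with θ).
  destruct (IH θ ((X, D) :: η) (VClos c :: σ)) as (vc & Hev & c' & -> & Hc').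
  - assumption.
  - constructor; [now split|assumption].
  - constructor; [|now apply ctxI_fresh].
    eexists. split; [reflexivity|]. intros Ms' a'' HMs' Ha''.
    rewrite interp_fresh in Ha'' by assumption.
    (* A corecursive call suspends again, hence lands in [C] and so in [D]. *)
    eexists. split; [|constructor].
    rewrite tyI_fvar_args by assumption.
    apply (proj1 (kle_kpis Us θ _ _) HCD); [assumption|]. apply HC; eauto.
  - destruct (Hc' Ns a' HNs) as (w & Hw & Hap).
    + now rewrite interp_fresh.
    + rewrite interp_topen_fvar in Hw by assumption.
      eexists. split; [reflexivity|]. exists w. split; [assumption|].
      econstructor; eassumption.
Qed.

Lemma sound_ind Δ Ξ Γ t0 ts T :
  sound Δ Ξ Γ t0 (tysub (inst [izero]) T) ->
  sound (inat :: Δ) (tvsub (ishift 1) Ξ) (T :: ctxsub (ishift 1) Γ) ts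
    (tysub (scat [isuc (ivar 0)] (ishift 1)) T) ->
  sound Δ Ξ Γ (Fn (GInd t0 ts)) (TArr [inat] TUnit T).
Proof.
  intros IH0 IHs θ η σ Hθ Hη Hσ.
  eexists. split; [constructor|].
  eexists. split; [reflexivity|]. intros [|N [|? ?]] a HN Ha; try easy.
  2: { destruct HN as [_ []]. }
  simpl in Ha. subst a. destruct HN as [HN _].
  unfold itypeI in HN. pose proof HN as HN'. rewrite (iusub_inat HL) in HN'.
  apply (ityping_inat_closed HL) in HN'. destruct HN' as [n ->]. clear HN.
  (* Induction on the numeral follows the two evaluation rules for [GInd]. *)
  simpl. induction n as [|n (w & Hw & Hap)].
  - destruct (IH0 θ η σ) as (w & Hev & Hw); auto.
    unfold tyI in Hw. rewrite interp_inst in Hw. simpl in Hw.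
    rewrite (isub_izero HL) in Hw. exists w. split; [exact Hw|]. now constructor.
  - destruct (IHs (num n :: θ) η (w :: σ)) as (w' & Hev & Hw').
    + constructor; [assumption|]. rewrite (iusub_inat HL).
      apply (ityping_inat_closed HL). eauto.
    + apply tvctxI_sub with θ; [now rewrite comp_ishift1_lsub|assumption].
    + constructor; [exact Hw|].
      apply ctxI_sub with θ; [now rewrite comp_ishift1_lsub|assumption].
    + unfold tyI in Hw'.
      rewrite (interp_tysub T _ [] _ (isuc (num n) :: θ)) in Hw'
        by now rewrite comp_isuc_lsub.
      exists w'. split; [exact Hw'|]. econstructor; eassumption.
Qed.

(* Simultaneous induction on checking and synthesis *)
Scheme check_mut := Minimality for check Sort Prop
  with synth_mut := Minimality for synth Sort Prop.
Combined Scheme check_synth_ind from check_mut, synth_mut.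

(** Supplies the kinding of the type of an eliminated term, from which its index arguments are
    recovered. *)
Lemma synth_presup Δ Ξ Γ t T : synth Δ Ξ Γ t T -> presup Δ Ξ Γ T.
Proof. now destruct 1. Qed.

Lemma synth_kcheck Δ Ξ Γ t T : synth Δ Ξ Γ t T -> kcheck Δ Ξ T KStar.
Proof. intros H. apply synth_presup in H. apply H. Qed.

Lemma check_synth_sound :
  (forall Δ Ξ Γ t T, check Δ Ξ Γ t T -> sound Δ Ξ Γ t T) /\
  (forall Δ Ξ Γ t T, synth Δ Ξ Γ t T -> sound Δ Ξ Γ t T).
Proof.
  apply check_synth_ind.
  all: try (intros; eapply sound_rec; eassumption).
  all: try (intros; eapply sound_corec; eassumption).
  all: try (intros; eapply sound_ind; eassumption).
  all: intros; intros θ η σ Hθ Hη Hσ.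
  - exists VUnit. split; [constructor|reflexivity].
  - destruct (H1 θ η σ) as (v1 & E1 & V1); auto.
    destruct (H3 θ η σ) as (v2 & E2 & V2); auto.
    exists (VPair v1 v2). split; [now constructor|]. now exists v1, v2.
  - destruct (H1 θ η σ) as (v & E & v1 & v2 & -> & V1 & V2); auto.
    destruct (H3 θ η (v2 :: v1 :: σ)) as (w & Ew & Vw); auto.
    { repeat constructor; auto. }
    exists w. split; [|assumption]. econstructor; eassumption.
  - destruct (H1 θ η σ) as (v & E & V); auto.
    exists (VIn in1 v). split; [now constructor|]. left. exists v. auto.
  - destruct (H1 θ η σ) as (v & E & V); auto.
    exists (VIn in2 v). split; [now constructor|]. right. exists v. auto.
  - destruct (H1 θ η σ) as (v & E & [(v' & V & ->)|(v' & V & ->)]); auto.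
    + destruct (H3 θ η (v' :: σ)) as (w & Ew & Vw); auto.
      { now constructor. }
      exists w. split; [|assumption]. eapply ev_case1; eassumption.
    + destruct (H5 θ η (v' :: σ)) as (w & Ew & Vw); auto.
      { now constructor. }
      exists w. split; [|assumption]. eapply ev_case2; eassumption.
  - destruct (H2 θ η σ) as (v & E & V); auto.
    unfold tyI in V. rewrite interp_inst in V.
    exists (VPack (isub (lsub θ) M) v). split; [now constructor|].
    exists (isub (lsub θ) M), v. split; [reflexivity|]. split; [|exact V].
    exact (ityping_lsub HL _ _ H0 Hθ).
  - destruct (H1 θ η σ) as (v & E & N & v' & -> & HN & V); auto.
    destruct (H3 (N :: θ) η (v' :: σ)) as (w & Ew & Vw).
    + now constructor.
    + apply tvctxI_sub with θ; [now rewrite comp_ishift1_lsub|assumption].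
    + constructor; [exact V|].
      apply ctxI_sub with θ; [now rewrite comp_ishift1_lsub|assumption].
    + unfold tyI in Vw. rewrite interp_ishift1 in Vw.
      exists w. split; [|exact Vw]. econstructor; eassumption.
  - subst. exists VRefl. now repeat constructor.
  (* A value of the equality type makes [θ] a closed unifier, which failure of unification
     excludes. *)
  - exfalso. destruct (H1 θ η σ) as (v & _ & _ & V); auto.
    destruct (kcheck_eq_inv Δ Ξ M N) as (U & HM & HN).
    { now apply synth_kcheck with (1 := H0). }
    destruct H as [HΔ _].
    exact (iunify_fail HL _ _ _ HΔ HM HN H2 (@wf_ictx_nil L) Hθ V).
  - destruct (H1 θ η σ) as (v & Es & -> & V); auto.
    destruct (kcheck_eq_inv Δ Ξ M N) as (U & HM & HN).
    { now apply synth_kcheck with (1 := H0). }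
    destruct H as [HΔ _].
    destruct (iunify_unifier HL _ _ _ _ _ HΔ HM HN H2) as (_ & HΘ & _).
    destruct (imatch_complete HL _ _ _ _ _ HΔ HM HN Hθ V H2) as (θ' & Hmatch).
    destruct (imatch_sound HL _ _ _ HΘ Hmatch) as (Hθ' & Hcomp).
    (* [θ] factors as [Θ] followed by the matched [θ'], so contexts and type refined by [Θ] mean at
       [θ'] what the original ones mean at [θ]; [η] and [σ] stay the same. *)
    assert (E : lsub θ = comp (lsub θ') (lsub Θ)) by now rewrite comp_lsub, Hcomp.
    destruct (H4 θ' η σ) as (w & Ew & Vw); auto.
    { now apply tvctxI_sub with θ. }
    { now apply ctxI_sub with θ. }
    unfold tyI in Vw. rewrite (interp_tysub T _ [] _ θ) in Vw by assumption.
    exists w. split; [|exact Vw]. econstructor; eassumption.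
  - eexists. split; [constructor|].
    eexists. split; [reflexivity|]. intros Ms a HMs Ha.
    pose proof (teleI_length _ _ _ HMs) as Hlen.
    destruct (H1 (rev Ms ++ θ) η (a :: σ)) as (w & Ew & Vw).
    + now apply subty_teleI.
    + apply tvctxI_sub with θ; [now rewrite comp_ishift_lsub|assumption].
    + constructor; [exact Ha|].
      apply ctxI_sub with θ; [now rewrite comp_ishift_lsub|assumption].
    + exists w. split; [exact Vw|]. now constructor.
  - destruct (H1 θ η σ) as (v & Ev & V); auto.
    destruct H as (_ & _ & _ & HK).
    pose proof (proj1 (lc_tapps _ _ _) (kcheck_lc _ _ _ _ HK)) as Hlc.
    unfold tyI in V. rewrite interp_tunfold in V by exact Hlc.
    exists (VInMu v). split; [now constructor|].
    unfold tyI. rewrite interp_tapps.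
    (* Folding is valid at [Ms] because the kinding of the conclusion types these arguments. *)
    apply (kspine_kle _ _ _ _ θ _ _ (kcheck_mu_inv _ _ _ _ _ HK) Hθ (kmu_fold _ _ _)).
    apply delem_dapps_dlift; [apply tagS_strict|].
    exists v. split; [|reflexivity].
    rewrite dapps_tlams by apply length_map. exact V.
  - destruct (H1 θ η σ) as (v & Ev & V); auto.
    exists (VInL l_zero v). split; [now constructor|].
    unfold tyI in *. rewrite interp_tapps in *. rewrite interp_rec_zero.
    apply delem_dapps_dlift; [apply tagS_strict|]. now exists v.
  - destruct (H1 θ η σ) as (v & Ev & V); auto.
    destruct H as (_ & _ & _ & HK).
    pose proof (proj1 (lc_tapps _ _ _) (kcheck_lc _ _ _ _ HK)) as Hlc.
    destruct (closed_pred Δ N θ) as [n Hn]; [|assumption|].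
    { now apply kcheck_rec_inv with (1 := HK). }
    exists (VInL l_suc v). split; [now constructor|].
    unfold tyI in *. rewrite interp_tapps in *.
    unfold R in *. rewrite (interp_rec_suc _ _ _ _ _ _ n) by assumption.
    apply delem_dapps_dlift; [apply tagS_strict|]. now exists v.
  - auto.
  - destruct (H2 θ η σ) as (v & Ev & V); auto.
    exists v. split; [assumption|].
    unfold tyI. now rewrite (interp_teq _ _ H0).
  - destruct (ctxI_nth_error _ _ _ _ _ _ Hσ H0) as (v & Ev & V).
    exists v. split; [now constructor|exact V].
  - destruct (H1 θ η σ) as (v & Et & c & -> & V); auto.
    destruct (H4 θ η σ) as (a & Es & Va); auto.
    unfold tyI in Va. rewrite interp_inst in Va.
    destruct (V _ a (spine_teleI _ _ _ _ H2 Hθ) Va) as (w & Hw & Hap).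
    exists w. split; [econstructor; eassumption|].
    unfold tyI. now rewrite interp_inst.
  - destruct (H1 θ η σ) as (v & Ev & V); auto.
    unfold tyI in *. rewrite interp_tapps in *. rewrite interp_rec_zero in V.
    apply delem_dapps_dlift in V; [|apply tagS_strict].
    destruct V as (v' & V & ->). exists v'. split; [now constructor|exact V].
  - destruct (H1 θ η σ) as (v & Ev & V); auto.
    pose proof (synth_kcheck _ _ _ _ _ H0) as HK.
    pose proof (proj1 (lc_tapps _ _ _) (kcheck_lc _ _ _ _ HK)) as Hlc.
    destruct (closed_pred Δ N θ) as [n Hn]; [|assumption|].
    { now apply kcheck_rec_inv with (1 := HK). }
    unfold tyI in *. rewrite interp_tapps in *.
    unfold R in *. rewrite (interp_rec_suc _ _ _ _ _ _ n) in V by assumption.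
    apply delem_dapps_dlift in V; [|apply tagS_strict].
    destruct V as (v' & V & ->). exists v'. split; [now constructor|exact V].
  - destruct (H1 θ η σ) as (v & Ev & V); auto.
    pose proof (synth_kcheck _ _ _ _ _ H0) as HK.
    pose proof (proj1 (lc_tapps _ _ _) (kcheck_lc _ _ _ _ HK)) as Hlc.
    unfold tyI in V. rewrite interp_tapps in V.
    apply (kspine_kle _ _ _ _ θ _ _ (kcheck_nu_inv _ _ _ _ _ HK) Hθ (knu_unfold _ _ _)) in V.
    apply delem_dapps_dlift in V; [|apply outS_strict].
    destruct V as (c & -> & w & V & Hout).
    rewrite dapps_tlams in V by apply length_map.
    exists w. split; [econstructor; eassumption|].
    unfold tyI. rewrite interp_tunfold by exact Hlc. exact V.
  - destruct (H1 θ η σ) as (v & Ev & V); auto.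
    exists v. split; [now constructor|exact V].
  - destruct (H2 θ η σ) as (v & Ev & V); auto.
    exists v. split; [assumption|].
    unfold tyI. now rewrite (interp_teq _ _ H0).
Qed.

End Termination.

Theorem theorem25 (L : index_sig) (HL : index_laws L)
  (Δ : ictx L) (Ξ : tvctx L) (Γ : ctx L) (t : tm L) (T : ty L)
  (θ : isubst L) (η : tvenv L) (σ : env L) :
  check Δ Ξ Γ t T \/ synth Δ Ξ Γ t T ->
  subty [] θ Δ -> tvctxI Ξ θ η -> ctxI Γ θ η σ ->
  exists v : val L, eval t θ σ v /\ tyI T θ η v.
Proof.
  intros [H|H]; revert θ η σ; now apply (check_synth_sound HL) in H.
Qed.
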